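(* Let $d\geqslant 2$ be an integer. The map $\Phi_{d\#}:\mathscr{P}(\mathbb{S}^1)\to\mathscr{P}(\mathbb{S}^1)$ has a G\^ateaux derivative at the uniform measure $\lambda$, equal to $d$ times the Perron-Frobenius operator of $\Phi_d$ acting on $L^2_0(\lambda)$. In particular its spectrum is the closed disc of radius $d$ centered at $0$ in $\mathbb{C}$, and all complex numbers of modulus $<d$ are eigenvalues with infinite multiplicity (i.e. with infinite-dimensional eigenspace).
   Context: $\mathbb{S}^1=\mathbb{R}/\mathbb{Z}$, $\lambda$ is the Lebesgue (uniform) probability measure, $\Phi_d(x)=dx\bmod 1$, $\mathscr{P}(\mathbb{S}^1)$ is the set of Borel probability measures on $\mathbb{S}^1$ and $\Phi_{d\#}$ is push-forward of measures. $\mathrm{W}$ is the quadratic Wasserstein metric: $\mathrm{W}(\mu,\nu)=\left(\inf_\Pi\int|x-y|^2\,\Pi(dx\,dy)\right)^{1/2}$, infimum over probability measures $\Pi$ on $\mathbb{S}^1\times\mathbb{S}^1$ with marginals $\mu,\nu$, where $|x-y|$ is the distance on $\mathbb{S}^1$. Vector fields on $\mathbb{S}^1$ are identified with functions $v:\mathbb{S}^1\to\mathbb{R}$. For $\mu\in\mathscr{P}(\mathbb{S}^1)$, $L^2_0(\mu)$ is the closure in $L^2(\mu)$ of the set of derivatives of smooth functions $\mathbb{S}^1\to\mathbb{R}$; in particular $L^2_0(\lambda)=\{v\in L^2(\lambda):\int v\,d\lambda=0\}$. For $v\in L^2(\mu)$, $\mu+v:=(\mathrm{Id}+v)_\#\mu$,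 the push-forward of $\mu$ by $x\mapsto x+v(x)\bmod 1$. A map $f:\mathscr{P}(\mathbb{S}^1)\to\mathscr{P}(\mathbb{S}^1)$ has G\^ateaux derivative $L$ at an atomless $\mu$ if $f(\mu)$ has no atom, $L:L^2_0(\mu)\to L^2_0(f(\mu))$ is a continuous linear operator, and for all $v\in L^2_0(\mu)$ one has $\mathrm{W}(f(\mu+tv),f(\mu)+tLv)=o(t)$ as $t\to0$. The Perron-Frobenius operator of $\Phi_d$ on $L^2_0(\lambda)$ is the adjoint of $u\mapsto u\circ\Phi_d$ on $L^2_0(\lambda)$; thus $d$ times it is the operator $\mathscr{L}_d v(x)=v(x/d)+v((x+1)/d)+\dots+v((x+d-1)/d)$. Spectrum, eigenvalues and eigenspaces are understood for the complexified operator on the complexification of $L^2_0(\lambda)$. *)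

(* Defs.v *)
From HB Require Import structures.
From mathcomp Require Import all_boot all_order all_algebra.
From mathcomp Require Import all_classical all_reals all_analysis.
From mathcomp Require Import measurable_realfun.
From mathcomp Require Import lra.
From mathcomp Require Import complex.

Set Implicit Arguments.
Unset Strict Implicit.
Unset Printing Implicit Defensive.

Import Order.TTheory GRing.Theory Num.Theory.
Import numFieldNormedType.Exports.

Local Open Scope classical_set_scope.
Local Open Scope ring_scope.

(* The circle R/Z is modelled by its fundamental domain [0,1[; [circle_proj]
   is the quotient map and the distance is the quotient distance. *)
Record circle (R : realType) := Circle {
  circle_repr : R ;
  circle_reprP : (0 <= circle_repr < 1)%R
}.

Section Circle.
Variable R : realType.

HB.instance Definition _ := [isSub for @circle_repr R].
HB.instance Definition _ := [Choice of circle R by <:].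

Lemma circle_proj_subproof (x : R) : 0 <= x - (Num.floor x)%:~R < 1.
Proof. by have /andP[] := floor_itv x; rewrite intrD; lra. Qed.

Definition circle_proj (x : R) : circle R := Circle (circle_proj_subproof x).

HB.instance Definition _ := isPointed.Build (circle R) (circle_proj 0).

Definition circle_dist (x y : circle R) : R :=
  Num.min `|circle_repr x - circle_repr y|
    (1 - `|circle_repr x - circle_repr y|).

Lemma circle_distxx x : circle_dist x x = 0.
Proof. by rewrite /circle_dist subrr normr0 subr0 min_l. Qed.

Lemma circle_dist_sym x y : circle_dist x y = circle_dist y x.
Proof. by rewrite /circle_dist distrC. Qed.

Lemma circle_dist_positivity x y : circle_dist x y = 0 -> x = y.
Proof.
move=> d0; apply: val_inj => /=; move: d0; rewrite /circle_dist.
move: (circle_reprP x) (circle_reprP y) => /andP[x0 x1] /andP[y0 y1].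
by case: leP => _; case: ger0P => ? ?; lra.
Qed.

Lemma circle_dist_triangle y x z :
  circle_dist x z <= circle_dist x y + circle_dist y z.
Proof.
rewrite /circle_dist.
move: (circle_reprP x) (circle_reprP y) (circle_reprP z).
move: (circle_repr x) (circle_repr y) (circle_repr z) => {}x {}y {}z.
move=> /andP[x0 x1] /andP[y0 y1] /andP[z0 z1].
case: (leP `|x - z|); case: (leP `|x - y|); case: (leP `|y - z|);
case: (ger0P (x - y)); case: (ger0P (y - z)); case: (ger0P (x - z)); lra.
Qed.

HB.instance Definition _ := isMetric.Build R (circle R)
  circle_distxx circle_dist_positivity circle_dist_sym circle_dist_triangle.

HB.instance Definition _ :=
  @isMeasurable.Build (sigma_display (@open (circle R))) (circle R)
    <<s @open (circle R) >> (@sigma_algebra0 _ setT _) (@sigma_algebraC _ _)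
    (@sigma_algebra_bigcup _ setT _).


Lemma measurable_circle_proj :
  @measurable_fun _ _ (measurableTypeR R) (circle R) setT circle_proj.
Proof.
apply: (@measurability _ _ _ _ _ _ (@open (circle R))) => //.
move=> _ [U oU <-]; rewrite setTI; apply: open_measurable.
rewrite openE => x Ux; rewrite /interior.
have /nbhs_ballP[e /= e0 eU] : nbhs (circle_proj x) U.
  by move: oU; rewrite openE; exact.
apply/nbhs_ballP; exists (Num.min e (1 / 2)) => /=.
  by rewrite lt_min e0/=; lra.
move=> y /=; rewrite /ball/= lt_min => /andP[xye xy2].
apply: eU; rewrite ballEmdist /=; apply: le_lt_trans xye.
rewrite /mdist/= /circle_dist /=.
have := floor_itv x; have := floor_itv y.
set m := Num.floor x; set n := Num.floor y.
rewrite !intrD !mulr1z => /andP[n0 n1] /andP[m0 m1].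
have mnR (i j : int) : i < j -> i%:~R + 1 <= j%:~R :> R.
  by rewrite -lezD1 -(ler_int R) intrD.
rewrite ge_min.
have [/mnR mn|/mnR mn|mn] := ltgtP m n.
- apply/orP; right; move: xy2; move: mn m0 m1 n0 n1.
  move: m%:~R n%:~R => {}m {}n mn m0 m1 n0 n1.
  by case: (ger0P (x - y)); case: (ger0P (x - m - (y - n))) => *; lra.
- apply/orP; right; move: xy2; move: mn m0 m1 n0 n1.
  move: m%:~R n%:~R => {}m {}n mn m0 m1 n0 n1.
  by case: (ger0P (x - y)); case: (ger0P (x - m - (y - n))) => *; lra.
- by rewrite mn opprB addrA subrK lexx.
Qed.

(* As a measurable space, [R] is canonically equipped with another display
   than [measurableTypeR R], on which [uniform_prob] lives. *)
Definition circle_mproj : {mfun measurableTypeR R >-> circle R} :=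
  @mfun_Sub _ _ (measurableTypeR R) (circle R) circle_proj
    (mem_set measurable_circle_proj).

Lemma measurable_circle_repr :
  measurable_fun [set: circle R] (@circle_repr R).
Proof.
apply: (measurability _ (RGenOInfty.measurableE R)) => //.
move=> _ [_ [a ->] <-]; rewrite setTI.
suff : @open (circle R) [set x | circle_repr x \in `]a, +oo[].
  exact: sub_sigma_algebra.
rewrite openE => x /=; rewrite in_itv/= andbT => ax; rewrite /interior.
apply/nbhs_ballP; have /andP[x0 x1] := circle_reprP x.
exists (Num.min (circle_repr x - a) (1 - circle_repr x)) => /=.
  by rewrite lt_min; lra.
move=> y; rewrite ballEmdist/= in_itv/= andbT lt_min /mdist/= /circle_dist.
have /andP[y0 y1] := circle_reprP y.
move: (circle_repr x) (circle_repr y) ax x0 x1 y0 y1 => {}x {}y ax x0 x1 y0 y1.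
by case: (leP `|x - y|) => _; case: (ger0P (x - y)) => ? /andP[? ?]; lra.
Qed.

HB.instance Definition _ := @isMeasurableFun.Build _ _
  (circle R) R (@circle_repr R) measurable_circle_repr.

Definition expanding (d : nat) (x : circle R) : circle R :=
  circle_proj (d%:R * circle_repr x).

Lemma measurable_expanding d : measurable_fun [set: circle R] (expanding d).
Proof.
apply: (measurableT_comp measurable_circle_proj).
exact: (measurable_funM (measurable_cst _) measurable_circle_repr).
Qed.

HB.instance Definition _ d := @isMeasurableFun.Build _ _
  (circle R) (circle R) (expanding d) (measurable_expanding d).

Definition displace (v : {mfun circle R >-> R}) (x : circle R) : circle R :=
  circle_proj (circle_repr x + v x).

Lemma measurable_displace v : measurable_fun [set: circle R] (displace v).
Proof.
apply: (measurableT_comp measurable_circle_proj).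
by apply: (measurable_funD measurable_circle_repr).
Qed.

HB.instance Definition _ v := @isMeasurableFun.Build _ _
  (circle R) (circle R) (displace v) (measurable_displace v).

Definition uniform_circle : probability (circle R) R :=
  distribution (uniform_prob (@ltr01 R) : probability (measurableTypeR R) R)
    circle_mproj.

Definition push_expanding d (mu : probability (circle R) R) :
  probability (circle R) R := distribution mu (expanding d).

Definition coupling (mu nu : probability (circle R) R) :
    set (probability (circle R * circle R)%type R) :=
  [set P | (forall A, measurable A -> pushforward P fst A = mu A) /\
           (forall A, measurable A -> pushforward P snd A = nu A)].

(* The infimum is finite: the product measure is a coupling, and the cost is
   at most 1/4. *)
Definition wasserstein (mu nu : probability (circle R) R) : R :=
  Num.sqrt (fine (ereal_inf
    [set (\int[P]_z ((mdist z.1 z.2) ^+ 2)%:E)%E | P in coupling mu nu])).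

End Circle.

Section L2.
Context {disp : measure_display} {T : measurableType disp} {R : realType}.
Variable mu : {measure set T -> \bar R}.

Local Notation Lf := (LfunType mu (lee1n 2)).

Definition null_fun : {pred Lf} :=
  [pred f : Lf | `[< {ae mu, forall x, f x = 0} >] ].

Lemma null_fun_submod_closed : submod_closed null_fun.
Proof.
split; first by apply/asboolP; apply/aeW.
move=> a f g /asboolP f0 /asboolP g0; apply/asboolP.
move: f0 g0; apply: filterS2 => x /= fx gx. by rewrite [LHS](_ : _ = a * f x + g x)// fx gx mulr0 addr0.
Qed.

HB.instance Definition _ :=
  GRing.isSubmodClosed.Build R Lf null_fun null_fun_submod_closed.

(* [LspaceType] carries no algebraic structure, hence this quotient of
   [LfunType]. *)
Definition L2 : Type := Quotient.quot null_fun.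
HB.instance Definition _ := GRing.Zmodule.on L2.

Definition L2_class (f : Lf) : L2 := \pi_(Quotient.quot null_fun)%qT f.
Definition L2_repr (v : L2) : Lf := repr (v : Quotient.quot null_fun).
Coercion L2_repr : L2 >-> LfunType.

Lemma L2_reprK v : L2_class (L2_repr v) = v. Proof. exact: reprK. Qed.

Lemma L2_classP f g :
  L2_class f = L2_class g <-> {ae mu, forall x, f x = g x}.
Proof.
have -> : (L2_class f = L2_class g) <-> (f - g \in null_fun).
  by rewrite (Quotient.idealrBE null_fun); split => [/eqP|/eqP].
split => [/asboolP|h]; last apply/asboolP; [|move: h];
  apply: filterS => x.
  by move=> fgx; apply/eqP; rewrite -subr_eq0; apply/eqP; exact: fgx.
by move=> fgx; rewrite [LHS](_ : _ = f x - g x)// fgx subrr.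
Qed.


Definition L2_scale (a : R) (v : L2) : L2 := L2_class (a *: (L2_repr v : Lf)).

Lemma L2_reprP (f : Lf) : {ae mu, forall x, L2_class f x = f x}.
Proof. by apply/L2_classP; rewrite L2_reprK. Qed.

Lemma L2_classD f g : L2_class (f + g) = L2_class f + L2_class g.
Proof. by rewrite /L2_class !piE. Qed.

Lemma L2_classZ a f : L2_class (a *: f) = L2_scale a (L2_class f).
Proof.
apply/L2_classP; apply: filterS (L2_reprP f) => x fx.
rewrite [LHS](_ : _ = a * f x)// -fx.
by [].
Qed.

Lemma L2_scaleA a b v : L2_scale a (L2_scale b v) = L2_scale (a * b) v.
Proof. by rewrite -[v]L2_reprK -!L2_classZ scalerA. Qed.

Lemma L2_scale1 : left_id 1 L2_scale.
Proof. by move=> v; rewrite -[v]L2_reprK -!L2_classZ scale1r. Qed.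

Lemma L2_scaleDr : right_distributive L2_scale +%R.
Proof.
move=> a v w; rewrite -[v]L2_reprK -[w]L2_reprK.
by rewrite -L2_classD -!L2_classZ -L2_classD scalerDr.
Qed.

Lemma L2_scaleDl v : {morph L2_scale^~ v : a b / a + b}.
Proof.
by move=> a b; rewrite -[v]L2_reprK -!L2_classZ -L2_classD scalerDl.
Qed.

HB.instance Definition _ := GRing.Zmodule_isLmodule.Build R L2
  L2_scaleA L2_scale1 L2_scaleDr L2_scaleDl.

Lemma L2_addE (v w : L2) : {ae mu, forall x, (v + w : L2) x = v x + w x}.
Proof.
have := L2_reprP (L2_repr v + L2_repr w).
by rewrite L2_classD !L2_reprK.
Qed.

Lemma L2_scaleE a (v : L2) : {ae mu, forall x, (a *: v : L2) x = a * v x}.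
Proof.
have := L2_reprP (a *: L2_repr v).
by rewrite L2_classZ !L2_reprK.
Qed.

Definition L2_norm (v : L2) : R := fine ('N[mu]_2%:E[EFin \o v])%E.

Lemma Lnorm2_ae_eq (f g : Lf) : {ae mu, forall x, f x = g x} ->
  ('N[mu]_2%:E[EFin \o f] = 'N[mu]_2%:E[EFin \o g])%E.
Proof.
move=> fg; rewrite unlock; congr (_ `^ _)%E.
have mL (h : Lf) : measurable_fun setT (fun x => `|(EFin \o h) x| `^ 2)%E.
  apply: (measurableT_comp (measurable_poweR _)).
  by apply: measurableT_comp => //; apply: measurableT_comp => //.
by apply: ae_eq_integral => //; apply: filterS fg => x /= ->.
Qed.

Lemma L2_normD v w : L2_norm (v + w) <= L2_norm v + L2_norm w.
Proof.
rewrite /L2_norm (Lnorm2_ae_eq (g := L2_repr v + L2_repr w)); last exact: L2_addE.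
exact: ler_LnormD.
Qed.

Lemma L2_normZ a v : L2_norm (a *: v) = `|a| * L2_norm v.
Proof.
rewrite /L2_norm (Lnorm2_ae_eq (g := a *: L2_repr v)); last exact: L2_scaleE.
by rewrite LnormZ -(finite_norm_fine (L2_repr v)) -EFinM.
Qed.

Lemma L2_norm0_eq0 v : L2_norm v = 0 -> v = 0.
Proof.
move=> /fine_Lnormr_eq0 v0; rewrite -[v]L2_reprK -[0]L2_reprK.
apply/L2_classP.
have z0 : {ae mu, forall x, (0 : L2) x = 0}.
  have := L2_reprP 0; rewrite (_ : L2_class 0 = 0)//.
  by rewrite /L2_class piE.
by move: v0 z0; apply: filterS2 => x v0 ->; exact: v0.
Qed.

HB.instance Definition _ := Lmodule_isNormed.Build R L2
  L2_normD L2_normZ L2_norm0_eq0.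

End L2.


Section CircleL20.
Context {R : realType}.
Implicit Types phi psi : circle R -> R.

(* The 1-periodic function on the line associated with [phi]. *)
Definition circle_lift phi : R -> R := phi \o @circle_proj R.

Definition circle_smooth phi :=
  forall n x, derivable (derive1n n (circle_lift phi)) x 1.

Definition circle_deriv phi : circle R -> R :=
  derive1 (circle_lift phi) \o @circle_repr R.

Variable mu : probability (circle R) R.

Definition smooth_derivatives : set (L2 mu) :=
  [set v | exists phi, circle_smooth phi /\
                       {ae mu, forall x, v x = circle_deriv phi x}].

Lemma circle_smooth_lin a phi psi n :
  circle_smooth phi -> circle_smooth psi ->
  derive1n n (circle_lift (a \*: phi \+ psi)) =
  a \*: (derive1n n (circle_lift phi)) \+ (derive1n n (circle_lift psi)).
Proof.
move=> sphi spsi; elim: n => [//|n IH].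
apply/funext => x; rewrite derive1nS IH derive1E deriveD//.
  by rewrite deriveZ//= -!derive1E.
by apply: derivableZ; exact: sphi.
Qed.

Lemma smooth_derivatives_closed a (v w : L2 mu) :
  smooth_derivatives v -> smooth_derivatives w ->
  smooth_derivatives (a *: v + w).
Proof.
move=> [phi [sphi vphi]] [psi [spsi wpsi]].
exists (a \*: phi \+ psi); split.
  move=> n x; rewrite circle_smooth_lin//.
  by apply: derivableD => //; exact: derivableZ.
have avE := L2_scaleE a v; have addE := L2_addE (a *: v) w.
near=> x.
have -> : (a *: v + w : L2 mu) x = (a *: v : L2 mu) x + w x by near: x.
have -> : (a *: v : L2 mu) x = a * v x by near: x.
have -> : v x = circle_deriv phi x by near: x.
have -> : w x = circle_deriv psi x by near: x.
rewrite /circle_deriv /=.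
by rewrite -!derive1n1 (circle_smooth_lin a 1 sphi spsi).
Unshelve. all: by end_near. Qed.

Definition L20_pred : {pred L2 mu} := mem (closure smooth_derivatives).

Lemma smooth_derivatives0 : smooth_derivatives 0.
Proof.
have d0 n : derive1n n (circle_lift (cst 0)) = cst 0.
  elim: n => [//|n IH]; rewrite derive1nS IH.
  by apply/funext => x; rewrite derive1_cst.
exists (cst 0); split; first by move=> n x; rewrite d0; exact: derivable_cst.
have := L2_scaleE 0 (0 : L2 mu); rewrite scale0r; apply: filterS => x ->.
by rewrite mul0r /circle_deriv /= -derive1n1 d0.
Qed.

Lemma L20_submod_closed : submod_closed L20_pred.
Proof.
split; first by rewrite inE; apply: subset_closure; exact: smooth_derivatives0.
move=> a v w; rewrite !inE => vD wD B nB.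
have cvgl : (fun z : L2 mu * L2 mu => a *: z.1 + z.2) @ (v, w) --> a *: v + w.
  by apply: cvgD; [apply: cvgZr; exact: cvg_fst|exact: cvg_snd].
have [[A1 A2] /= [nA1 nA2] AB] := cvgl _ nB.
have [v' [Dv' Av']] := vD _ nA1; have [w' [Dw' Aw']] := wD _ nA2.
by exists (a *: v' + w'); split;
  [exact: smooth_derivatives_closed|exact: (AB (v', w'))].
Qed.



HB.instance Definition _ :=
  GRing.isSubmodClosed.Build R (L2 mu) L20_pred L20_submod_closed.

Record L20 : Type := MkL20 {
  L20_val : L2 mu ;
  L20_valP : L20_val \in L20_pred
}.

HB.instance Definition _ := [isSub for L20_val].
HB.instance Definition _ := [Choice of L20 by <:].
HB.instance Definition _ := [SubChoice_isSubLmodule of L20 by <:].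

Lemma L20_normD (v w : L20) :
  `|L20_val (v + w)| <= `|L20_val v| + `|L20_val w|.
Proof. exact: ler_normD. Qed.

Lemma L20_normZ (a : R) (v : L20) : `|L20_val (a *: v)| = `|a| * `|L20_val v|.
Proof. exact: normrZ. Qed.

Lemma L20_norm0_eq0 (v : L20) : `|L20_val v| = 0 -> v = 0.
Proof. by move=> /normr0_eq0 v0; apply: val_inj. Qed.

HB.instance Definition _ := Lmodule_isNormed.Build R L20
  L20_normD L20_normZ L20_norm0_eq0.

End CircleL20.

Coercion L20_val : L20 >-> L2.

Section Derivative.
Context {R : realType}.

(* The push-forward [mu + v]: on measurable sets it does not depend on the
   representative of the class [v]. *)
Definition displacement (mu : probability (circle R) R) (v : L2 mu) :
  probability (circle R) R := distribution mu (displace v).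

Definition atomless (mu : probability (circle R) R) :=
  forall x, mu [set x] = 0%E.

(* The type [probability] distinguishes set functions that differ on
   non-measurable sets; the definition is only meaningful for an [f] that, like
   a push-forward, does not depend on the values there. *)
Definition gateaux_derivative
    (f : probability (circle R) R -> probability (circle R) R)
    (mu : probability (circle R) R) (L : {linear L20 mu -> L20 (f mu)}) :=
  [/\ atomless mu, atomless (f mu), continuous L &
      forall v : L20 mu,
        (fun t : R => wasserstein (f (displacement (t *: v : L20 mu)))
                                  (displacement (t *: L v : L20 (f mu))))
        =o_ (0 : R) (fun t : R => t)].

Definition L20_inner (mu : probability (circle R) R) (v w : L20 mu) : R :=
  \int[mu]_x (v x * w x).

Local Notation lambda := (uniform_circle R).

Definition koopman (d : nat) (K : {linear L20 lambda -> L20 lambda}) :=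
  forall u : L20 lambda, {ae lambda, forall x, K u x = u (expanding d x)}.

(* [P] is the adjoint of the composition operator [K]. *)
Definition perron_frobenius (d : nat) (P : {linear L20 lambda -> L20 lambda}) :=
  exists2 K : {linear L20 lambda -> L20 lambda}, koopman d K &
    forall u v, L20_inner (P v) u = L20_inner v (K u).

End Derivative.

Arguments gateaux_derivative {R} f mu L.

Section Spectrum.
Context {R : realType}.
Variable V : normedModType R.

Definition complexification : Type := (V * V)%type.

HB.instance Definition _ :=
  GRing.Zmodule.copy complexification (V * V)%type.
HB.instance Definition _ := Topological.copy complexification (V * V)%type.

(* [(u, v)] stands for [u + i v]. *)
Definition complexification_scale (z : R[i]) (w : complexification) :
    complexification :=
  (complex.Re z *: w.1 - complex.Im z *: w.2,
   complex.Re z *: w.2 + complex.Im z *: w.1).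

Lemma complexification_scaleA a b w :
  complexification_scale a (complexification_scale b w) =
  complexification_scale (a * b) w.
Proof.
case: a b w => [a a'] [b b'] [u v]; congr pair; rewrite /=;
  rewrite !(scalerBr, scalerDr, scalerBl, scalerDl, scalerA, opprD) -!addrA;
  by congr (_ + _); rewrite addrA addrC.
Qed.

Lemma complexification_scale1 : left_id 1 complexification_scale.
Proof. by case=> u v; congr pair; rewrite /= !scale1r scale0r ?subr0 ?addr0. Qed.

Lemma complexification_scaleDr : right_distributive complexification_scale +%R.
Proof.
move=> a [u v] [u' v']; congr pair; rewrite /= !scalerDr ?opprD;
  exact: addrACA.
Qed.

Lemma complexification_scaleDl w :
  {morph complexification_scale^~ w : a b / a + b}.
Proof.
move=> [a a'] [b b']; congr pair; rewrite /= !scalerDl ?opprD; exact: addrACA.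
Qed.

HB.instance Definition _ := GRing.Zmodule_isLmodule.Build R[i] complexification
  complexification_scaleA complexification_scale1
  complexification_scaleDr complexification_scaleDl.

Definition complexify (T : {linear V -> V}) (w : complexification) :
  complexification := (T w.1, T w.2).

(* [S] is the inverse of [complexify T - z], so its linearity is automatic. *)
Definition complex_spectrum (T : {linear V -> V}) : set R[i] :=
  [set z | ~ exists S : complexification -> complexification,
    [/\ continuous S,
        cancel S (fun w => complexify T w - z *: w) &
        cancel (fun w => complexify T w - z *: w) S] ].

Definition complex_eigenspace (T : {linear V -> V}) (z : R[i]) :
    set complexification :=
  [set w | complexify T w = z *: w].

Definition infinite_dimensional (E : set complexification) :=
  forall n, exists2 w : 'I_n -> complexification, forall i, E (w i) &
    forall c : 'I_n -> R[i], \sum_i c i *: w i = 0 -> forall i, c i = 0.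

End Spectrum.

(* Main.v *)
From HB Require Import structures.
Require Import Defs.
From mathcomp Require Import all_boot all_order all_algebra.
From mathcomp Require Import all_classical all_reals all_analysis.
From mathcomp Require Import measurable_realfun.
From mathcomp Require Import ring lra.
From mathcomp Require Import complex.

Set Implicit Arguments.
Unset Strict Implicit.
Unset Printing Implicit Defensive.

Import Order.TTheory GRing.Theory Num.Theory.
Import numFieldNormedType.Exports.

Local Open Scope classical_set_scope.
Local Open Scope ring_scope.

(* The uniform measure [lambda] is the mean of its images under the [d] inverse
   branches of the expanding map Phi, so Phi preserves [lambda], the operator
   [u |-> u \o Phi] is an isometry K of L^2, and its adjoint P averages [u] over
   the branches. Both map derivatives of smooth functions to derivatives of smooth
   functions, hence act on [L20 lambda].

   For the derivative, Phi(X + t v(X)) with X uniform has to be compared with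
   Y + t (L v)(Y) for a uniform Y coupled to X. Approximate v within eta by a
   smooth g, and cut the circle into N cells on which g oscillates at most eta.
   On a cell with g frozen, the image law is a mixture of d translates of a
   uniform law, whose monotone rearrangement onto the uniform law defines
   Y = Psi(X). Away from the ends of the cells, a proportion O(N t) of the circle,
   it moves points by t times the deviation of the speed from its mean, which
   is L g. Hence W^2 <= O(N t^3) + O(eta^2 t^2).

   For the spectrum, P K = 1 and both are contractions. If |z| > d, then z - d P
   is inverted by a Neumann series. If |z| < d and P v = 0, the Neumann series
   solving w = v + (z / d) K w gives d P w = z w; the trigonometric functions of
   frequency 1 mod d provide infinitely many independent such v, and v is
   recovered from w. The circle |z| = d belongs to the spectrum because
   approximate eigenvectors rule out a bounded inverse. *)

(** * The uniform law on the unit interval: distribution function and mixtures *)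

Section Unit.
Context {R : realType}.
Local Notation U := (uniform_prob (@ltr01 R) : probability (measurableTypeR R) R).

(** Coupling the two laws through Phi itself would compare [Phi x + t d v(x)] with
    [Phi x + t (L v)(Phi x)]. The d preimages of a point carry different speeds, so this gap is in
    general of order t, however smooth v is. The second point is therefore displaced as well, by a
    map Psi depending on t. Psi must preserve lambda exactly, since the second marginal is
    prescribed; this is why the speed is frozen on cells: for constant speeds the rearrangement is
    an explicit distribution function, and the error of freezing is charged to the cost instead of
    the marginal.

    Only an upper bound on W is needed, so one coupling suffices. The choices are made in the order
    eta (from the required precision), g, N (from a Lipschitz constant of g), and t last. Points
    near the ends of cells are misplaced by O(t) on a set of measure O(N t); this is the term N t^3,
    which is o(t^2) because N is fixed before t. *)

(** The distribution function of the uniform law, see [unif_rayc]. *)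
Definition clamp (x : R) : R := Num.max 0 (Num.min x 1).

Variant clamp_spec x : R -> Prop :=
| ClampLow of x <= 0 : clamp_spec x 0
| ClampMid of 0 <= x & x <= 1 : clamp_spec x x
| ClampHigh of 1 <= x : clamp_spec x 1.

Lemma clampP x : clamp_spec x (clamp x).
Proof.
rewrite /clamp; case: (leP x 1) => x1; last first.
  by rewrite max_r//; apply: ClampHigh; exact: ltW.
by case: (leP 0 x) => x0; [exact: ClampMid|apply: ClampLow; exact: ltW].
Qed.

Lemma clamp_itv x : 0 <= clamp x <= 1.
Proof. by case: clampP => *; lra. Qed.

Lemma clamp_id x : 0 <= x <= 1 -> clamp x = x.
Proof. by case: clampP => *; lra. Qed.

Lemma clamp0 x : x <= 0 -> clamp x = 0.
Proof. by case: clampP => *; lra. Qed.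

Lemma clamp1 x : 1 <= x -> clamp x = 1.
Proof. by case: clampP => *; lra. Qed.

Lemma clamp_le x y : x <= y -> clamp x <= clamp y.
Proof. by case: clampP => *; case: clampP => *; lra. Qed.

Lemma clamp_lip x y : `|clamp x - clamp y| <= `|x - y|.
Proof.
case: clampP => *; case: clampP => *; case: (ger0P (x - y)) => *;
  rewrite ?ler_norml; lra.
Qed.

Lemma measurable_clamp : measurable_fun setT clamp.
Proof. by apply: measurable_maxr => //; exact: measurable_minr. Qed.

Lemma unifE A : U A = (\int[lebesgue_measure]_(x in A `&` `[0%R, 1%R]%classic) (uniform_pdf 0 1 x)%:E)%E.
Proof. exact: integral_uniform_pdf. Qed.

Lemma unif_ray b : U `]b, +oo[%classic = (1 - clamp b)%:E.
Proof.
rewrite unifE.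
rewrite (_ : _ `&` _ = if b < 0 then `[0, 1]%classic else `]b, 1]%classic); last first.
  apply/seteqP; split => x/=; case: ltP => b0 /=; rewrite ?in_itv/= ?andbT.
  - by case.
  - by case=> -> /andP[_ ->].
  - by move=> x01; rewrite x01; split => //; move: x01 => /andP[x0 _]; exact: lt_le_trans x0.
  - by move=> /andP[bx x1]; rewrite bx x1 (le_trans b0 (ltW bx)).
rewrite (eq_integral (cst 1%E)); last first.
  move=> x; rewrite inE/=; case: ifPn; rewrite /= in_itv/= /uniform_pdf subr0 invr1.
    by move=> _ ->.
  by move=> b0 /andP[bx x1]; rewrite ifT//; lra.
rewrite integral_cst/=; last by case: ifPn.
rewrite mul1e; case: ifPn => b0.
  by rewrite lebesgue_measure_itv/= lte_fin ltr01 clamp0 ?ltW// oppr0 subr0 adde0.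
rewrite lebesgue_measure_itv/= lte_fin; case: ltP => b1.
  by rewrite clamp_id -?EFinD//; lra.
by rewrite clamp1// subrr.
Qed.

Lemma unif_rayc b : U `]-oo, b]%classic = (clamp b)%:E.
Proof.
rewrite -setCitvr probability_setC//.
by rewrite [X in (_ - X)%E]unif_ray -EFinB opprB addrCA subrr addr0.
Qed.

Lemma unif_itvco : U `[0, 1[%classic = 1%E.
Proof.
rewrite unifE.
rewrite (_ : _ `&` _ = `[0, 1[%classic); last first.
  apply/seteqP; split => x/=; rewrite !in_itv/=; first by case.
  by move=> /andP[x0 x1]; rewrite x0 x1 ltW.
rewrite (eq_integral (cst 1%E)); last first.
  by move=> x; rewrite inE/= in_itv/= /uniform_pdf subr0 invr1 => ?; rewrite ifT//; lra.
by rewrite integral_cst//= mul1e lebesgue_measure_itv/= lte_fin ltr01 oppr0 adde0.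
Qed.

(** The uniform law is defined on the closed interval while the circle is modelled by [[0, 1[]; the
    endpoint 1 is null. *)
Lemma unif_eq (A B : set (measurableTypeR R)) : measurable A -> measurable B ->
  (forall x : R, 0 <= x < 1 -> A x <-> B x) -> U A = U B.
Proof.
suff le (C D : set (measurableTypeR R)) : measurable C -> measurable D ->
    (forall x : R, 0 <= x < 1 -> C x -> D x) -> (U C <= U D)%E.
  by move=> mA mB AB; apply/eqP; rewrite eq_le !le// => x /AB[].
move=> mC mD CD.
have N0 : U (~` `[0, 1[%classic) = 0%E.
  by rewrite probability_setC//= [X in (_ - X)%E]unif_itvco subee.
have mN : measurable (~` `[0:R, 1[%classic : set (measurableTypeR R)) by exact: measurableC.
apply: (@le_trans _ _ (U (D `|` ~` `[0, 1[%classic))).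
  apply: le_measure; rewrite ?inE//; first exact: measurableU.
  move=> x Cx; have [x01|x01] := pselect (0 <= x < 1); first by left; exact: CD.
  by right; rewrite /= in_itv.
apply: (le_trans (measureU2 _ _ _)) => //.
by rewrite [X in (_ + X <= _)%E]N0 adde0.
Qed.

(** Rays together with [setT] form a pi-system generating the Borel sets. [setT] also serves as the
    exhausting sequence, hence the hypotheses on the total mass. *)
Lemma finite_measure_unique (m1 m2 : {measure set (measurableTypeR R) -> \bar R}) :
  (m1 setT < +oo)%E ->
  m1 setT = m2 setT ->
  (forall b, m1 `]b, +oo[%classic = m2 `]b, +oo[%classic) ->
  forall A, measurable A -> m1 A = m2 A.
Proof.
move=> fin mT mray A mA.
pose G : set (set (measurableTypeR R)) :=
  [set A | A = setT \/ exists x, A = `]x, +oo[%classic].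
apply: (@measure_unique _ _ _ G (fun=> setT)) => //.
- rewrite [LHS](RGenOInfty.measurableE R); apply/seteqP; split.
    by apply: sub_smallest2r => // B BG; right.
  apply: smallest_sub; first exact: smallest_sigma_algebra.
  move=> B [->|BG]; last exact: sub_sigma_algebra.
  exact: measurableT.
- move=> B C [->|[x ->]] [->|[y ->]]; rewrite ?setTI ?setIT; [by left|by right; exists y|by right; exists x|].
  right; exists (Num.max x y); apply/seteqP; split => z/=; rewrite !in_itv/= !andbT gt_max.
    by case=> -> ->.
  by move=> /andP[].
- by move=> _; left.
- by rewrite -subTset => x _; exists 0%N.
- by move=> B [->//|[x ->]].
Qed.

Lemma unif_mixture (d : nat) (f : 'I_d -> measurableTypeR R -> measurableTypeR R) :
  (forall k, measurable_fun setT (f k)) ->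
  (forall b, (\sum_k U (f k @^-1` `]b, +oo[%classic) = d%:R%:E * (1 - clamp b)%:E)%E) ->
  forall B, measurable B -> (\sum_k U (f k @^-1` B) = d%:R%:E * U B)%E.
Proof.
move=> mf tail B mB.
(* [msum] takes a family indexed by [nat]; [inord] extends the given one, for which [d] has to be a
   successor. *)
case: d f mf tail => [|d] f mf tail; first by rewrite big_ord0 mul0e.
pose g (n : nat) : {mfun measurableTypeR R >-> measurableTypeR R} :=
  mfun_Sub (mem_set (mf (inord n))).
pose mu (n : nat) : {measure set (measurableTypeR R) -> \bar R} :=
  distribution U (g n).
have muE A : msum mu d.+1 A = (\sum_(k < d.+1) U (f k @^-1` A))%E.
  by rewrite /msum; apply: eq_bigr => i _; rewrite /= /distribution /pushforward /= inord_val.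
rewrite -muE.
have ed : (0 <= d.+1%:R :> R) by [].
pose nu := mscale (NngNum ed) U.
have nuE A : nu A = (d.+1%:R%:E * U A)%E by [].
rewrite -nuE.
have UT : U setT = 1%E by exact: probability_setT.
have TT : msum mu d.+1 setT = d.+1%:R%:E.
  rewrite muE (eq_bigr (fun=> 1%E)); last by move=> i _; rewrite preimage_setT.
  by rewrite sumEFin sumr_const card_ord.
apply: finite_measure_unique => //.
- by rewrite /= TT ltry.
- by rewrite /= TT /mscale/= [X in (_ * X)%E]UT mule1.
by move=> b; rewrite [LHS]muE tail [RHS]nuE unif_ray.
Qed.

(** For nonnegative [x], the term [clamp (x - k)] is the length of the part of [[0, x]] inside
    [[k, k + 1]], and these lengths add up. *)
Lemma sum_clamp (n : nat) (x : R) :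
  \sum_(k < n) clamp (x - k%:R) = Num.max 0 (Num.min x n%:R).
Proof.
elim: n => [|n IH].
  by rewrite big_ord0 max_l// ge_min lexx orbT.
rewrite big_ord_recr/= IH -natr1.
have : 0 <= n%:R :> R by [].
move: (n%:R) => m m0; case: clampP => xm.
- by rewrite addr0 !min_l//; lra.
- by move=> xm1; rewrite min_r ?min_l ?max_r//; lra.
- by rewrite !min_r ?max_r//; lra.
Qed.

Lemma unif_branches (d : nat) (B : set (measurableTypeR R)) : (0 < d)%N -> measurable B ->
  (\sum_(k < d) U ((fun x => (x + k%:R) / d%:R)%R @^-1` B) = d%:R%:E * U B)%E.
Proof.
move=> d0; have d0R : 0 < d%:R :> R by rewrite ltr0n.
apply: (@unif_mixture d (fun (k : 'I_d) x => (x + k%:R) / d%:R)) => [k|b].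
  by apply: measurable_funM => //; exact: measurable_funD.
rewrite (eq_bigr (fun k : 'I_d => (1 - clamp (b * d%:R - k%:R))%:E)); last first.
  move=> k _; rewrite -unif_ray; congr (U _); apply/seteqP; split => x/=;
  by rewrite !in_itv/= !andbT ltr_pdivlMr// ltrBlDr.
rewrite sumEFin -EFinM; congr (_%:E); rewrite big_split/= sumr_const card_ord.
rewrite sumrN sum_clamp mulrBr mulr1; congr (_ - _).
rewrite /clamp maxr_pMr ?ltW// mulr0 minr_pMr ?ltW// mulr1.
by rewrite mulrC.
Qed.

Lemma clamp_continuous : continuous clamp.
Proof.
move=> x; apply/cvgrPdist_le => e e0; near=> y.
apply: (le_trans (clamp_lip _ _)).
by near: y; apply: cvgr_dist_le => //; exact: cvg_id.
Unshelve. all: by end_near. Qed.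

(* If [U] is uniform and [K] an independent uniform index, the distribution
   function [G x] of [U + s_K] is the mean of the [clamp (x - s_j)], so that
   [G (U + s_K)] is uniform. *)
Lemma unif_rearrangement (d : nat) (s : 'I_d -> R) (B : set (measurableTypeR R)) :
  (0 < d)%N -> measurable B ->
  (\sum_(k < d) U ((fun x => d%:R^-1 * \sum_(j < d) clamp (x + s k - s j))%R @^-1` B) =
  d%:R%:E * U B)%E.
Proof.
move=> d0; have d0R : 0 < d%:R :> R by rewrite ltr0n.
pose G x := d%:R^-1 * \sum_(j < d) clamp (x - s j).
have Gle x y : x <= y -> G x <= G y.
  by move=> xy; rewrite ler_pM2l ?invr_gt0//; apply: ler_sum => i _; apply: clamp_le; lra.
have G0 x : 0 <= G x.
  rewrite mulr_ge0 ?invr_ge0 ?(ltW d0R)//.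
  by apply: sumr_ge0 => i _; have /andP[] := clamp_itv (x - s i).
have G1 x : G x <= 1.
  rewrite /G mulrC ler_pdivrMr// mul1r -[leRHS](_ : \sum_(j < d) 1 = _); last by rewrite sumr_const card_ord.
  by apply: ler_sum => i _; have /andP[] := clamp_itv (x - s i).
have mG : measurable_fun setT G.
  apply: measurable_funM => //; apply: measurable_sum => i.
  by apply: (measurableT_comp measurable_clamp); exact: measurable_funB.
have cG : continuous G.
  move=> x; apply: cvgM; first exact: cvg_cst.
  rewrite /=; apply: cvg_big => //; first exact: add_continuous.
  move=> i _; apply: (@continuous_comp R R R (fun x => x - s i) clamp); last exact: clamp_continuous.
  by apply: cvgB; [exact: cvg_id|exact: cvg_cst].
(* A bound for all shifts: [G] is 0 at [- M] and 1 at [M + 1], so every level in between is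
   attained. *)
pose M := \sum_(j < d) `|s j|.
have sM j : `|s j| <= M.
  by rewrite /M (bigD1 j)//= lerDl sumr_ge0.
have M0 : 0 <= M by rewrite sumr_ge0.
have ivt b : 0 <= b <= 1 -> exists x, G x = b.
  move=> /andP[b0 b1].
  have GM : G (- M) = 0.
    rewrite /G big1 ?mulr0// => j _; apply: clamp0.
    by have := sM j; case: ger0P; lra.
  have GM1 : G (M + 1) = 1.
    rewrite /G (eq_bigr (fun=> 1)); last first.
      by move=> j _; apply: clamp1; have := sM j; case: ger0P; lra.
    by rewrite sumr_const card_ord mulVf// gt_eqF.
  have [|||c _ <-] := @IVT _ G (- M) (M + 1) b; first by lra.
  - exact: continuous_subspaceT.
  - by rewrite GM GM1; case: (leP 0 1) => //=; lra.
  - by exists c.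
apply: (@unif_mixture d (fun (k : 'I_d) x => G (x + s k))) => [k|b].
  by apply: (measurableT_comp mG); exact: measurable_funD.
have shiftray k x : U ((fun y : R => y + s k) @^-1` `]x, +oo[%classic) = (1 - clamp (x - s k))%:E.
  rewrite -unif_ray; congr (U _).
  by apply/seteqP; split => z/=; rewrite !in_itv/= !andbT ltrBlDr.
have sumray x : (\sum_k U ((fun y : R => y + s k)%R @^-1` `]x, +oo[%classic) = (d%:R * (1 - G x))%:E)%E.
  rewrite (eq_bigr _ (fun k _ => shiftray k x)) sumEFin; congr (_%:E).
  by rewrite big_split/= sumr_const card_ord sumrN mulrBr mulr1 /G mulVKf// gt_eqF.
have mGray k c : measurable ((fun y : R => G (y + s k)) @^-1` `]c, +oo[%classic : set (measurableTypeR R)).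
  rewrite -[X in measurable X]setTI; apply: (_ : measurable_fun setT _) => //.
  by apply: (measurableT_comp mG); exact: measurable_funD.
have mray k c : measurable ((fun y : R => y + s k) @^-1` `]c, +oo[%classic : set (measurableTypeR R)).
  by rewrite -[X in measurable X]setTI; apply: (_ : measurable_fun setT _) => //; exact: measurable_funD.
have [b0|b0] := ltP b 0.
  rewrite clamp0 ?ltW// (eq_bigr (fun=> 1%E)).
    by rewrite sumEFin sumr_const card_ord subr0 mule1.
  move=> k _; rewrite (_ : _ @^-1` _ = setT) ?probability_setT//.
  by apply/seteqP; split => // x _ /=; rewrite in_itv/= andbT; exact: lt_le_trans (G0 _).
have [b1|b1] := leP 1 b.
  rewrite clamp1// subrr mule0 big1// => k _.
  rewrite (_ : _ @^-1` _ = set0) ?measure0//.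
  apply/seteqP; split => // x /=; rewrite in_itv/= andbT.
  by have := G1 (x + s k); lra.
rewrite clamp_id -?EFinM; last by lra.
apply/eqP; rewrite eq_le; apply/andP; split.
  have [|x Gx] := ivt b; first by lra.
  rewrite -[in leRHS]Gx -sumray; apply: lee_sum => k _.
  apply: le_measure; rewrite ?inE// => y/=.
  by rewrite !in_itv/= !andbT -Gx; apply: contraTT; rewrite -!leNgt; exact: Gle.
(* [G] may have flat pieces, so [y > x] does not give [G y > G x]. Starting from a level [b']
   slightly above [b] restores the strict inequality; the total mass [d] explains [e / d], and the
   cap at 1 keeps [b'] in the range of [G]. *)
apply/lee_subgt0Pr => _/posnumP[e].
pose b' := Num.min 1 (b + e%:num / d%:R).
have [|x Gx] := ivt b'.
  by rewrite le_min ler01/= ge_min lexx/= addr_ge0// divr_ge0.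
apply: (@le_trans _ _ (d%:R * (1 - b'))%:E).
  rewrite -EFinD lee_fin.
  have : b' <= b + e%:num / d%:R by rewrite ge_min lexx orbT.
  rewrite -lerBlDl ler_pdivlMr// => h.
  by rewrite mulrBr mulr1 mulrBr mulr1; move: h; rewrite mulrBl mulrC (mulrC b); lra.
rewrite -Gx -sumray; apply: lee_sum => k _.
apply: le_measure; rewrite ?inE// => y/=.
rewrite !in_itv/= !andbT => xy; apply: (@lt_le_trans _ _ (G x)); last by rewrite Gle// ltW.
by rewrite Gx lt_min b1/= ltrDl divr_gt0.
Qed.

End Unit.

(** * The circle, its inverse branches and the uniform measure *)

Section CircleMeasure.
Context {R : realType}.
Local Notation U := (uniform_prob (@ltr01 R) : probability (measurableTypeR R) R).
Local Notation lambda := (uniform_circle R).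
Local Notation S1 := (circle R).

Lemma circle_reprK (z : S1) : circle_proj (circle_repr z) = z.
Proof.
apply: val_inj => /=; have /andP[z0 z1] := circle_reprP z.
rewrite (@floor_def _ _ 0) ?subr0//.
by rewrite z0 add0r z1.
Qed.

Lemma circle_projK (x : R) : 0 <= x < 1 -> circle_repr (circle_proj x) = x.
Proof. by move=> x01; rewrite /= (@floor_def _ _ 0) ?subr0// add0r. Qed.

Lemma circle_proj_addz (x : R) (m : int) : circle_proj (x + m%:~R) = circle_proj x.
Proof.
apply: val_inj => /=; rewrite floorDrz ?intr_int// intrKfloor intrD.
by rewrite opprD addrACA subrr addr0.
Qed.

Lemma circle_proj_addn (x : R) (n : nat) : circle_proj (x + n%:R) = circle_proj x.
Proof. by rewrite -(circle_proj_addz x n) -pmulrn. Qed.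

Lemma circle_proj_repr (x : R) : exists m : int, x = circle_repr (circle_proj x) + m%:~R.
Proof. by exists (Num.floor x); rewrite /= subrK. Qed.

Lemma circle_dist_proj (x y : R) :
  circle_dist (circle_proj x) (circle_proj y) <= `|x - y|.
Proof.
rewrite /circle_dist /=.
have := floor_itv x; have := floor_itv y.
set m := Num.floor x; set n := Num.floor y.
rewrite !intrD !mulr1z => /andP[n0 n1] /andP[m0 m1].
have mnR (i j : int) : i < j -> i%:~R + 1 <= j%:~R :> R.
  by rewrite -lezD1 -(ler_int R) intrD.
rewrite ge_min.
have [/mnR mn|/mnR mn|->] := ltgtP m n; last by rewrite opprB addrA subrK lexx.
- move: mn m0 m1 n0 n1; move: m%:~R n%:~R => {}m {}n mn m0 m1 n0 n1.
  by case: (ger0P (x - y)); case: (ger0P (x - m - (y - n))) => *; lra.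
- move: mn m0 m1 n0 n1; move: m%:~R n%:~R => {}m {}n mn m0 m1 n0 n1.
  by case: (ger0P (x - y)); case: (ger0P (x - m - (y - n))) => *; lra.
Qed.

Definition branch (d k : nat) (z : S1) : S1 :=
  circle_proj ((circle_repr z + k%:R) / d%:R).

Lemma measurable_branch d k : measurable_fun setT (branch d k).
Proof.
apply: (measurableT_comp (@measurable_circle_proj R)).
apply: measurable_funM => //.
exact: (measurable_funD (@measurable_circle_repr R) (measurable_cst _)).
Qed.

Lemma circle_repr_branch d k z : (k < d)%N ->
  circle_repr (branch d k z) = (circle_repr z + k%:R) / d%:R.
Proof.
move=> kd; have /andP[z0 z1] := circle_reprP z.
have d0 : 0 < d%:R :> R by rewrite ltr0n (leq_ltn_trans _ kd).
rewrite circle_projK// divr_ge0 ?addr_ge0 ?(ltW d0)//= ltr_pdivrMr// mul1r.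
have : k.+1%:R <= d%:R :> R by rewrite ler_nat.
by rewrite -natr1; lra.
Qed.

Lemma expanding_branch d k z : (k < d)%N -> expanding d (branch d k z) = z.
Proof.
move=> kd; rewrite /expanding circle_repr_branch// mulrC mulfVK ?circle_proj_addn ?circle_reprK//.
by rewrite pnatr_eq0 -lt0n (leq_ltn_trans _ kd).
Qed.

Lemma measurable_proj_preimage (A : set S1) : measurable A ->
  measurable ((@circle_proj R : measurableTypeR R -> S1) @^-1` A).
Proof. by move=> mA; rewrite -[X in measurable X]setTI; exact: measurable_circle_proj. Qed.

Lemma uniform_circleE A : lambda A = U (@circle_proj R @^-1` A).
Proof. by []. Qed.

Lemma uniform_circle_repr (B : set (measurableTypeR R)) : measurable B ->
  lambda (@circle_repr R @^-1` B) = U B.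
Proof.
move=> mB; rewrite uniform_circleE; apply: unif_eq => //.
  apply: measurable_proj_preimage.
  by rewrite -[X in measurable X]setTI; exact: measurable_circle_repr.
by move=> x x01; rewrite /preimage/mkset circle_projK.
Qed.

Lemma unif_real_branches d A : (0 < d)%N -> measurable A ->
  (\sum_(k < d) U ((fun x => circle_proj ((x + k%:R) / d%:R)) @^-1` A) =
   d%:R%:E * lambda A)%E.
Proof.
by move=> d0 mA; rewrite uniform_circleE -unif_branches//; exact: measurable_proj_preimage.
Qed.

Lemma uniform_circle_branches d A : (0 < d)%N -> measurable A ->
  (\sum_(k < d) lambda (branch d k @^-1` A) = d%:R%:E * lambda A)%E.
Proof.
move=> d0 mA; rewrite -unif_real_branches//; apply: eq_bigr => k _.
rewrite -uniform_circle_repr//.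
rewrite -[X in measurable X]setTI; apply: (_ : measurable_fun setT _) => //.
apply: (measurableT_comp (@measurable_circle_proj R)).
by apply: measurable_funM => //; exact: measurable_funD.
Qed.

End CircleMeasure.

(** * Integration against a mixture of image measures *)

Section Mixture.
Context d1 d2 (T1 : measurableType d1) (T2 : measurableType d2) (R : realType).
Variables (mu : {measure set T1 -> \bar R}) (nu : {measure set T2 -> \bar R}).
Variables (n : nat) (theta : nat -> T1 -> T2).
Hypothesis mtheta : forall k, measurable_fun setT (theta k).
Hypothesis mixture : forall A, measurable A ->
  (\sum_(k < n) mu (theta k @^-1` A) = n%:R%:E * nu A)%E.

Lemma ge0_integral_mixture (f : T2 -> \bar R) :
  measurable_fun setT f -> (forall x, 0 <= f x)%E ->
  (\sum_(k < n) \int[mu]_x f (theta k x) = n%:R%:E * \int[nu]_x f x)%E.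
Proof.
move=> mf f0.
pose m (k : nat) : {measure set T2 -> \bar R} :=
  pushforward mu (theta k).
transitivity (\int[msum (m mtheta) n]_x f x)%E.
  rewrite ge0_integral_measure_sum//; apply: eq_bigr => k _.
  exact/esym/(ge0_integral_pushforward (mtheta k)).
have n0 : 0 <= n%:R :> R by [].
rewrite -(@ge0_integral_mscale _ _ _ nu setT measurableT (NngNum n0) f)//.
by apply: eq_measure_integral => A mA _; exact: mixture.
Qed.

(** The integral of [|f \o theta k|] is one nonnegative term of a sum that equals [n] times the
    integral of [|f|]. *)
Lemma integrable_mixture (f : T2 -> R) k : (k < n)%N ->
  nu.-integrable setT (EFin \o f) -> mu.-integrable setT (EFin \o (f \o theta k)).
Proof.
move=> kn /integrableP[/measurable_EFinP mf fin]; apply/integrableP; split.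
  by apply/measurable_EFinP; exact: measurableT_comp.
have mg : measurable_fun setT (fun x => `|(f x)%:E|%E).
  by do 2 apply: measurableT_comp => //.
have := ge0_integral_mixture mg (fun x => abse_ge0 _).
rewrite (bigD1 (Ordinal kn))//= => E.
apply: (@le_lt_trans _ _ (n%:R%:E * \int[nu]_x `|(EFin \o f) x|)%E); last first.
  by rewrite lte_mul_pinfty// lee_fin.
rewrite -E leeDl// sume_ge0// => i _.
by apply: integral_ge0 => x _; rewrite lee_fin.
Qed.

Lemma Rintegral_mixture (f : T2 -> R) :
  nu.-integrable setT (EFin \o f) ->
  \sum_(k < n) \int[mu]_x (f (theta k x)) = n%:R * \int[nu]_x f x.
Proof.
move=> intf; have intk k := integrable_mixture (ltn_ord k) intf.
have mf : measurable_fun setT (EFin \o f) by have /integrableP[] := intf.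
apply: EFin_inj; rewrite -sumEFin EFinM.
rewrite fineK; last exact: integrable_fin_num intf.
rewrite (eq_bigr (fun k : 'I_n => (\int[mu]_x ((EFin \o f)^\+ (theta k x)) -
    \int[mu]_x ((EFin \o f)^\- (theta k x)))%E)); last first.
  move=> k _; rewrite fineK; last exact: integrable_fin_num (intk k).
  rewrite integralE; congr (_ - _)%E; apply: eq_integral => x _.
    by rewrite !funeposE.
  by rewrite !funenegE.
rewrite big_split/= fin_num_sumeN; last first.
  move=> i _.
  rewrite (_ : integral _ _ _ = \int[mu]_x (EFin \o (f \o theta i))^\- x)%E; last first.
    by apply: eq_integral => x _; rewrite !funenegE.
  by apply: integrable_fin_num => //; apply: integrable_funeneg.
rewrite (ge0_integral_mixture (f := (EFin \o f)^\+)%E)//; last exact: measurable_funepos.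
rewrite (ge0_integral_mixture (f := (EFin \o f)^\-)%E)//; last exact: measurable_funeneg.
rewrite [in RHS]integralE [RHS]muleBr// fin_num_adde_defl// fin_numN.
by apply: integrable_fin_num => //; apply: integrable_funeneg.
Qed.

End Mixture.

Lemma ge0_integral_preserving {d1 d2} {T1 : measurableType d1} {T2 : measurableType d2} {R : realType}
    (mu : {measure set T1 -> \bar R}) (nu : {measure set T2 -> \bar R})
    (psi : T1 -> T2) (f : T2 -> \bar R) :
  measurable_fun setT psi ->
  (forall A, measurable A -> mu (psi @^-1` A) = nu A) ->
  measurable_fun setT f -> (forall x, 0 <= f x)%E ->
  (\int[mu]_x f (psi x) = \int[nu]_x f x)%E.
Proof.
move=> mpsi psiE mf f0.
have H A : measurable A -> (\sum_(k < 1) mu (psi @^-1` A) = 1%:R%:E * nu A)%E.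
  by move=> mA; rewrite big_ord1 mul1e psiE.
have := ge0_integral_mixture (fun=> mpsi) H mf f0.
by rewrite big_ord1 mul1e.
Qed.

(** * Norms and equality in L2 through integrals of squares *)

Section L2Tools.
Context {d : measure_display} {T : measurableType d} {R : realType}.
Variable mu : {measure set T -> \bar R}.

Lemma sqr_Lnorm2 (f : T -> R) :
  ('N[mu]_2%:E[EFin \o f] `^ 2 = \int[mu]_x ((f x) ^+ 2)%:E)%E.
Proof.
rewrite poweR_Lnorm//; apply: eq_integral => x _ /=.
by rewrite powR_mulrn// -normrX ger0_norm ?sqr_ge0.
Qed.

Lemma L2_measurable (v : L2 mu) : measurable_fun setT v.
Proof. exact: measurable_funP. Qed.

Lemma L2_normE (v : L2 mu) : ((`|v| ^+ 2)%:E = \int[mu]_x ((v x) ^+ 2)%:E)%E.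
Proof.
rewrite -sqr_Lnorm2 -finite_norm_fine poweR_EFin powR_mulrn//.
exact: (normr_ge0 v).
Qed.

Lemma ae_eq_sqr_integral (f g : T -> R) :
  measurable_fun setT f -> measurable_fun setT g -> {ae mu, forall x, f x = g x} ->
  (\int[mu]_x ((f x) ^+ 2)%:E = \int[mu]_x ((g x) ^+ 2)%:E)%E.
Proof.
move=> mf mg fg; apply: ae_eq_integral => //.
- by apply/measurable_EFinP; exact: measurable_funX.
- by apply/measurable_EFinP; exact: measurable_funX.
- by apply: filterS fg => x ->.
Qed.

Lemma L2_norm_ae (v : L2 mu) f : measurable_fun setT f ->
  {ae mu, forall x, v x = f x} -> ((`|v| ^+ 2)%:E = \int[mu]_x ((f x) ^+ 2)%:E)%E.
Proof.
by move=> mf vf; rewrite L2_normE; apply: ae_eq_sqr_integral => //; exact: L2_measurable.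
Qed.

Lemma L2_of_sqr_integrable (f : T -> R) : measurable_fun setT f ->
  (\int[mu]_x ((f x) ^+ 2)%:E < +oo)%E ->
  exists v : L2 mu, {ae mu, forall x, v x = f x}.
Proof.
move=> mf fin.
have fL : f \in Lfun mu 2%:E.
  rewrite inE; apply/andP; split; rewrite inE//= /finite_norm.
  rewrite (@lty_poweRy _ _ 2)//; last by rewrite sqr_Lnorm2.
by exists (L2_class (Lfun_Sub (lee1n 2) fL)); exact: L2_reprP.
Qed.

Lemma L2_eqP (v w : L2 mu) : v = w <-> {ae mu, forall x, v x = w x}.
Proof. by rewrite -[in X in X <-> _](L2_reprK v) -[in X in X <-> _](L2_reprK w) L2_classP. Qed.

Lemma L2_subE (v w : L2 mu) : {ae mu, forall x, (v - w : L2 mu) x = v x - w x}.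
Proof.
have := L2_addE v (- w); have := L2_scaleE (-1) w; rewrite scaleN1r.
by apply: filterS2 => x -> ->; rewrite mulN1r.
Qed.

Lemma sqr_integral_eq0 (f : T -> R) : measurable_fun setT f ->
  (\int[mu]_x ((f x) ^+ 2)%:E <= 0)%E -> {ae mu, forall x, f x = 0}.
Proof.
move=> mf f0.
have mf2 : measurable_fun setT (fun x => ((f x) ^+ 2)%:E).
  by apply/measurable_EFinP; exact: measurable_funX.
have : (\int[mu]_x `|((f x) ^+ 2)%:E| = 0)%E.
  apply/eqP; rewrite eq_le; apply/andP; split; last by apply: integral_ge0 => x _; exact: abse_ge0.
  by under eq_integral do rewrite gee0_abs ?lee_fin ?sqr_ge0//.
move/(ae_eq_integral_abs mu measurableT mf2).
by apply: filterS => x /(_ I) /= [] /eqP; rewrite sqrf_eq0 => /eqP.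
Qed.

End L2Tools.

(** * Bounded operators on [L20] given by pointwise formulas *)

Section Operator.
Context {R : realType}.

Lemma circle_deriv_continuous (phi : circle R -> R) : circle_smooth phi ->
  continuous (derive1 (circle_lift phi)).
Proof.
by move=> sphi x; apply/differentiable_continuous/derivable1_diffP; exact: (sphi 1%N).
Qed.

Lemma measurable_circle_deriv (phi : circle R -> R) : circle_smooth phi ->
  measurable_fun setT (circle_deriv phi).
Proof.
move=> sphi; apply: (measurableT_comp (f := derive1 (circle_lift phi))).
  exact: continuous_measurable_fun (circle_deriv_continuous sphi).
exact: measurable_circle_repr.
Qed.

Lemma closure_normP (V : normedModType R) (S : set V) (v : V) :
  closure S v <-> forall e, 0 < e -> exists2 s, S s & `|v - s| < e.
Proof.
split=> [cl e e0|h B /nbhs_ballP[e/= e0 eB]].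
  have [s [Ss]] := cl (ball v e) (nbhsx_ballx _ _ e0).
  by rewrite -ball_normE; exists s.
have [s Ss vs] := h e e0; exists s; split => //.
by apply: eB; rewrite -ball_normE.
Qed.

(** [O] acts on functions, not on classes. Linearity and the bound send an almost everywhere null
    function to another one, so [O] descends to classes; continuity and the last hypothesis then
    carry the closure of the smooth derivatives over [mu] into the one over [nu]. *)
Lemma L20_operator (mu nu : probability (circle R) R)
    (O : (circle R -> R) -> circle R -> R) (C : R) :
  0 <= C ->
  (forall f, measurable_fun setT f -> measurable_fun setT (O f)) ->
  (forall a f g x, O (fun y => a * f y + g y) x = a * O f x + O g x) ->
  (forall f, measurable_fun setT f ->
    (\int[nu]_x ((O f x) ^+ 2)%:E <= C%:E * \int[mu]_x ((f x) ^+ 2)%:E)%E) ->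
  (forall phi, circle_smooth phi -> exists psi,
    circle_smooth psi /\ O (circle_deriv phi) =1 circle_deriv psi) ->
  exists T : {linear L20 mu -> L20 nu},
    (forall v, {ae nu, forall x, T v x = O v x}) /\
    (forall v, `|T v| ^+ 2 <= C * `|v| ^+ 2).
Proof.
move=> C0 mO linO boundO smoothO.
have O_ae f g : measurable_fun setT f -> measurable_fun setT g ->
    {ae mu, forall x, f x = g x} -> {ae nu, forall x, O f x = O g x}.
  move=> mf mg fg.
  have mh : measurable_fun setT (fun y => (-1) * f y + g y).
    by apply: measurable_funD => //; exact: measurable_funM.
  have /sqr_integral_eq0 : (\int[nu]_x ((O (fun y => (-1) * f y + g y) x) ^+ 2)%:E <= 0)%E.
    apply: (le_trans (boundO _ mh)).
    rewrite (ae_eq_sqr_integral (g := cst 0))//.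
      by rewrite /= expr0n/= integral0 mule0.
    by apply: filterS fg => x ->; rewrite mulN1r addNr.
  move=> /(_ (mO _ mh)); apply: filterS => x; rewrite linO mulN1r addrC => /eqP.
  by rewrite subr_eq0 => /eqP.
have exT0 (v : L2 mu) : {w : L2 nu | {ae nu, forall x, w x = O v x}}.
  apply: cid; apply: L2_of_sqr_integrable; first by apply: mO; exact: L2_measurable.
  apply: (le_lt_trans (boundO _ (L2_measurable v))).
  by rewrite -L2_normE -EFinM ltry.
pose T0 v := sval (exT0 v).
have T0E v : {ae nu, forall x, T0 v x = O v x} by exact: (svalP (exT0 v)).
have T0lin a (v w : L2 mu) : T0 (a *: v + w) = a *: T0 v + T0 w.
  apply/L2_eqP.
  have mvw : measurable_fun setT (fun y => a * (v : L2 mu) y + (w : L2 mu) y).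
    by apply: measurable_funD; [apply: measurable_funM => //|]; exact: L2_measurable.
  have : {ae nu, forall x, O (a *: v + w : L2 mu) x = O (fun y => a * (v : L2 mu) y + (w : L2 mu) y) x}.
    apply: (O_ae _ _ (L2_measurable (a *: v + w : L2 mu)) mvw).
    have := L2_addE (a *: v) w; have := L2_scaleE a v.
    by apply: filterS2 => x <- ->.
  move=> H; have := L2_addE (a *: T0 v) (T0 w); have := L2_scaleE a (T0 v).
  have := T0E v; have := T0E w; have := T0E (a *: v + w); move: H.
  move=> H1 H2 H3 H4 H5 H6; near=> x.
  have -> : T0 (a *: v + w) x = O (a *: v + w : L2 mu) x by near: x.
  have -> : O (a *: v + w : L2 mu) x = O (fun y => a * v y + w y) x by near: x.
  have -> : (a *: T0 v + T0 w : L2 nu) x = (a *: T0 v : L2 nu) x + T0 w x by near: x.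
  have -> : (a *: T0 v : L2 nu) x = a * T0 v x by near: x.
  have -> : T0 v x = O v x by near: x.
  have -> : T0 w x = O w x by near: x.
  exact: linO.
have T0norm v : `|T0 v| ^+ 2 <= C * `|v| ^+ 2.
  rewrite -lee_fin [leRHS]EFinM (L2_norm_ae (mO _ (L2_measurable v)) (T0E v)) L2_normE.
  exact: boundO (L2_measurable v).
have T0smooth v : smooth_derivatives v -> smooth_derivatives (T0 v).
  move=> [phi [sphi vphi]]; have [psi [spsi Opsi]] := smoothO _ sphi.
  exists psi; split => //.
  have mphi := measurable_circle_deriv sphi.
  have := O_ae _ _ (L2_measurable v) mphi vphi; have := T0E v.
  by apply: filterS2 => x -> ->; exact: Opsi.
have T0sub v w : T0 (v - w) = T0 v - T0 w.
  by rewrite addrC -scaleN1r T0lin scaleN1r addrC.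
have T0cl (v : L2 mu) : v \in @L20_pred R mu -> T0 v \in @L20_pred R nu.
  rewrite !inE => /closure_normP vS; apply/closure_normP => e e0.
  (* A Lipschitz constant that stays positive when [C] is 0, so that dividing by it is
     legitimate. *)
  pose M := Num.sqrt C + 1.
  have M0 : 0 < M by rewrite ltr_wpDl ?sqrtr_ge0.
  have [s Ss vs] := vS (e / M) (divr_gt0 e0 M0).
  exists (T0 s); first exact: T0smooth.
  rewrite -T0sub.
  have : `|T0 (v - s)| <= M * `|v - s|.
    rewrite -(@ler_pXn2r _ 2)// ?nnegrE ?mulr_ge0 ?(ltW M0)//.
    apply: (le_trans (T0norm _)); rewrite exprMn ler_wpM2r ?sqr_ge0//.
    rewrite -[leLHS]sqr_sqrtr// ler_pXn2r ?nnegrE ?sqrtr_ge0 ?(ltW M0)//.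
    by rewrite lerDl.
  by move/le_lt_trans; apply; rewrite mulrC -ltr_pdivlMr.
pose T (v : L20 mu) : L20 nu := MkL20 (T0cl _ (L20_valP v)).
have Tlin : linear T.
  by move=> a v w; apply: val_inj; exact: T0lin.
pose Tm := GRing.isLinear.Build R (L20 mu) (L20 nu) *:%R T Tlin.
pose TL : {linear L20 mu -> L20 nu} := HB.pack T Tm.
exists TL; split => v; first exact: T0E.
exact: T0norm.
Unshelve. all: by end_near. Qed.

End Operator.

(** * Smooth 1-periodic functions on the line *)

Section Periodic.
Context {R : realType}.
Implicit Types (g h : R -> R) (phi : circle R -> R).

Lemma periodic_addz h : (forall x, h (x + 1) = h x) -> forall (m : int) x, h (x + m%:~R) = h x.
Proof.
move=> h1 m x; have hn (n : nat) y : h (y + n%:R) = h y.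
  by elim: n => [|n IH]; rewrite ?addr0// -natr1 addrA h1.
case: m => n; first exact: hn.
by rewrite NegzE mulrNz -[in LHS](hn n.+1 (x - _)) subrK.
Qed.

Lemma circle_lift_repr h : (forall x, h (x + 1) = h x) ->
  circle_lift (h \o @circle_repr R) = h.
Proof.
move=> h1; apply/funext => x; have [m xm] := circle_proj_repr x.
by rewrite [in RHS]xm periodic_addz.
Qed.

Lemma circle_lift_periodic phi x : circle_lift phi (x + 1) = circle_lift phi x.
Proof. by rewrite /circle_lift /= (circle_proj_addn x 1). Qed.

Definition smooth g := forall n x, derivable (derive1n n g) x 1.

(** Exhibiting all derivatives at once as a family [G] proves smoothness and computes the
    derivatives in a single induction. *)
Lemma smooth_family (G : nat -> R -> R) :
  (forall n x, is_derive x (1 : R) (G n) (G n.+1 x)) ->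
  smooth (G 0%N) /\ forall n, derive1n n (G 0%N) = G n.
Proof.
move=> dG; have dE n : derive1n n (G 0%N) = G n.
  elim: n => // n IH; rewrite derive1nS IH; apply/funext => x.
  by rewrite derive1E; exact: derive_val.
by split => // n x; rewrite dE; exact: ex_derive.
Qed.

Lemma is_derive_smooth g n x : smooth g -> is_derive x (1 : R) (derive1n n g) (derive1n n.+1 g x).
Proof. by move=> sg; apply: DeriveDef => //; rewrite derive1nS derive1E. Qed.

Lemma is_derive_affine a c x : is_derive x (1 : R) (fun x : R => a * x + c) a.
Proof. by apply: is_derive_eq; rewrite addr0 scaler1/=. Qed.

Lemma smooth_affine g a c : smooth g -> smooth (fun x => g (a * x + c)) /\
  forall n, derive1n n (fun x => g (a * x + c)) = fun x => a ^+ n * derive1n n g (a * x + c).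
Proof.
move=> sg; pose G n x := a ^+ n * derive1n n g (a * x + c).
have G0 : G 0%N = fun x => g (a * x + c) by apply/funext => x; rewrite /G mul1r.
rewrite -G0; apply: smooth_family => n x.
have dg := is_derive_smooth n (a * x + c) sg.
have da := is_derive_affine a c x.
have := is_deriveZ (a ^+ n) (@is_derive1_comp _ _ (fun x => a * x + c) x _ _ dg da).
rewrite /G exprS => /is_derive_eq; apply.
by rewrite /GRing.scale/=; ring.
Qed.

Lemma smooth_lin g h a : smooth g -> smooth h -> smooth (fun x => a * g x + h x) /\
  forall n, derive1n n (fun x => a * g x + h x) = fun x => a * derive1n n g x + derive1n n h x.
Proof.
move=> sg sh; pose G n x := a * derive1n n g x + derive1n n h x.
apply: (smooth_family (G := G)) => n x.
have dg := is_derive_smooth n x sg.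
have dh := is_derive_smooth n x sh.
exact: (is_deriveD (is_deriveZ a dg) dh).
Qed.

Lemma smooth_cst c : smooth (fun=> c).
Proof.
have [] // := @smooth_family (fun n x => if n is 0%N then c else 0).
Qed.

Lemma smooth_sum (I : Type) (r : seq I) (g : I -> R -> R) : (forall i, smooth (g i)) ->
  smooth (fun x => \sum_(i <- r) g i x) /\
  derive1 (fun x => \sum_(i <- r) g i x) = fun x => \sum_(i <- r) derive1 (g i) x.
Proof.
move=> sg; elim: r => [|i r [IH1 IH2]].
  rewrite (_ : (fun _ => _) = fun=> 0); last by apply/funext => x; rewrite big_nil.
  split; first exact: smooth_cst.
  by apply/funext => x; rewrite big_nil derive1_cst.
rewrite (_ : (fun _ => _) = fun x => 1 * g i x + \sum_(i <- r) g i x); last first.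
  by apply/funext => x; rewrite big_cons mul1r.
have [s1 s2] := smooth_lin 1 (sg i) IH1; split => //.
by have := s2 1%N; rewrite !derive1n1 => ->; apply/funext => x; rewrite IH2 big_cons mul1r.
Qed.

(** The n-th derivative of the sine is the sine advanced by n quarter turns. *)
Lemma smooth_sin a c : smooth (fun x => sin (a * x + c)).
Proof.
have /(smooth_affine a c)[]// : smooth (@sin R).
rewrite (_ : @sin R = fun x => sin (x + 0%:R * (pi / 2))); last first.
  by apply/funext => x; rewrite mul0r addr0.
apply: (smooth_family (G := fun n x => sin (x + n%:R * (pi / 2))) _).1.
move=> n x; apply: is_derive_eq.
rewrite addr0 mulr1 -sinDpihalf; congr sin.
by rewrite -[in RHS]natr1; move: n%:R (pi / 2) => m p; ring.
Qed.

Lemma derive1_periodic g : smooth g -> (forall x, g (x + 1) = g x) ->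
  forall x, derive1 g (x + 1) = derive1 g x.
Proof.
move=> sg g1 x; have [_ /(_ 1%N)] := smooth_affine 1 1 sg.
rewrite (_ : (fun _ => _) = g); last by apply/funext => y; rewrite mul1r.
by move/(congr1 (@^~ x)); rewrite !derive1n1 => ->; rewrite !mul1r.
Qed.

(** Adding 1 to [x] shifts the index [k] by one. The sum is unchanged because the terms of index 0
    and [d] have arguments that differ by 1. *)
Lemma branch_sum_periodic (d : nat) g : (0 < d)%N -> (forall x, g (x + 1) = g x) ->
  forall x, \sum_(k < d) g ((x + 1 + k%:R) / d%:R) = \sum_(k < d) g ((x + k%:R) / d%:R).
Proof.
move=> d0 g1 x; have dR0 : d%:R != 0 :> R by rewrite pnatr_eq0 -lt0n.
pose G (k : nat) := g ((x + k%:R) / d%:R).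
transitivity (\sum_(k < d) G k.+1).
  by apply: eq_bigr => k _; rewrite /G -natr1 addrA addrAC.
apply/eqP; rewrite -subr_eq0 -sumrB -(big_mkord xpredT (fun k => G k.+1 - G k)).
by rewrite telescope_sumr// subr_eq0 /G addr0 mulrDl divff// g1.
Qed.

Lemma periodic_bounded h : continuous h -> (forall x, h (x + 1) = h x) ->
  exists2 M, 0 <= M & forall x, `|h x| <= M.
Proof.
move=> ch h1; have cn : {within `[0, 1], continuous (fun x => `|h x|)}.
  apply: continuous_subspaceT => x.
  by apply: (@continuous_comp _ _ _ h (fun y : R => `|y|)); [exact: ch|exact: norm_continuous].
have [c _ cM] := EVT_max (@ler01 R) cn.
exists `|h c| => // x; have [m ->] := circle_proj_repr x; rewrite periodic_addz//.
apply: cM; have /andP[x0 x1] := circle_reprP (circle_proj x).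
by rewrite in_itv/= x0 ltW.
Qed.

Lemma smooth_periodic_lipschitz g : smooth g -> (forall x, g (x + 1) = g x) ->
  exists2 M, 0 <= M & forall x y, `|g x - g y| <= M * `|x - y|.
Proof.
move=> sg g1.
have [|M M0 gM] := periodic_bounded _ (derive1_periodic sg g1).
  by move=> x; apply/differentiable_continuous/derivable1_diffP; exact: (sg 1%N).
exists M => //; suff le x y : x <= y -> `|g x - g y| <= M * `|x - y|.
  move=> x y; have [/le//|/ltW/le] := leP x y.
  by rewrite distrC (distrC x).
move=> xy; rewrite distrC (distrC x).
have [||c _ ->] := @MVT_segment R g (derive1 g) x y xy.
- by move=> z _; apply: DeriveDef; [exact: (sg 0%N)|rewrite derive1E].
- apply: continuous_subspaceT => z.
  by apply/differentiable_continuous/derivable1_diffP; exact: (sg 0%N).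
by rewrite normrM ler_wpM2r.
Qed.

Lemma circle_smooth_repr g : smooth g -> (forall x, g (x + 1) = g x) ->
  circle_smooth (g \o @circle_repr R) /\
  circle_deriv (g \o @circle_repr R) = derive1 g \o @circle_repr R.
Proof. by move=> sg g1; rewrite /circle_smooth/circle_deriv circle_lift_repr. Qed.

Lemma circle_deriv_proj phi x : circle_smooth phi ->
  circle_deriv phi (circle_proj x) = derive1 (circle_lift phi) x.
Proof.
move=> sphi; have [m xm] := circle_proj_repr x; rewrite [in RHS]xm periodic_addz//.
apply: derive1_periodic => //; exact: circle_lift_periodic.
Qed.

End Periodic.

(** Cauchy-Schwarz: twice the difference of the two sides is the sum of all [(a i - a j) ^+ 2]. *)
Lemma sqr_sum_le (R : realDomainType) (n : nat) (a : 'I_n -> R) :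
  (\sum_i a i) ^+ 2 <= n%:R * \sum_i a i ^+ 2.
Proof.
have : 0 <= \sum_i \sum_j (a i - a j) ^+ 2.
  by apply: sumr_ge0 => i _; apply: sumr_ge0 => j _; exact: sqr_ge0.
rewrite (_ : \sum_i _ = (n%:R * \sum_i a i ^+ 2 - (\sum_i a i) ^+ 2) *+ 2).
  by rewrite pmulrn_lge0// subr_ge0.
rewrite expr2 mulr_suml mulrnBl -sumrMnl.
transitivity (\sum_i (n%:R * a i ^+ 2 + \sum_j a j ^+ 2 - a i * (\sum_j a j) *+ 2)).
  apply: eq_bigr => i _; rewrite (eq_bigr (fun j => a i ^+ 2 + a j ^+ 2 - a i * a j *+ 2)).
    rewrite sumrB big_split/= sumr_const card_ord sumrMnl -mulr_sumr.
    by rewrite mulr_natl.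
  by move=> j _; rewrite sqrrB addrAC.
rewrite sumrB big_split/= -mulr_sumr sumr_const card_ord.
by rewrite [in RHS]mulr2n mulr_natl.
Qed.

(** * The composition operator and the transfer operators *)

Section Operators.
Context {R : realType} (d : nat) (d_gt0 : (0 < d)%N).
Local Notation lambda := (uniform_circle R).
Let dR0 : d%:R != 0 :> R. Proof. by rewrite pnatr_eq0 -lt0n. Qed.

(** The branches are sections of the expanding map, so each term of the mixture formula for the
    preimage of [A] is [lambda A]; the factor [d] is then cancelled among finite numbers. *)
Lemma uniform_circle_expanding A : measurable A ->
  lambda (expanding d @^-1` A) = lambda A.
Proof.
move=> mA.
have mEA : measurable (@expanding R d @^-1` A).
  by rewrite -[X in measurable X]setTI; exact: measurable_expanding.
have := uniform_circle_branches d_gt0 mEA.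
rewrite (eq_bigr (fun=> lambda A)); last first.
  move=> k _; congr (lambda _); apply/seteqP; split => z;
  by rewrite /preimage/= expanding_branch.
rewrite big_const_ord.
have /fineK <- : lambda A \is a fin_num by rewrite fin_num_measure.
have /fineK <- : lambda (expanding d @^-1` A) \is a fin_num by rewrite fin_num_measure.
move: (fine _) (fine _) => b a.
rewrite (_ : iter d _ _ = (d%:R * a)%:E); last first.
  by elim: (d) => [|n IH]; rewrite ?mul0r// iterS IH -EFinD -natr1; congr (_%:E); ring.
by rewrite -EFinM => -[] /(mulfI dR0) ->.
Qed.

Lemma ge0_integral_expanding (f : circle R -> \bar R) :
  measurable_fun setT f -> (forall x, 0 <= f x)%E ->
  (\int[lambda]_x f (expanding d x) = \int[lambda]_x f x)%E.
Proof.
move=> mf f0; apply: (ge0_integral_preserving (@measurable_expanding R d)) => //.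
exact: uniform_circle_expanding.
Qed.

Lemma koopman_exists : exists K : {linear L20 lambda -> L20 lambda},
  koopman d K /\ forall v, `|K v| ^+ 2 <= 1 * `|v| ^+ 2.
Proof.
apply: (L20_operator (O := fun f x => f (expanding d x))) => //.
- by move=> f mf; apply: measurableT_comp => //; exact: measurable_expanding.
- move=> f mf; rewrite mul1e.
  rewrite (ge0_integral_expanding (f := fun x => ((f x) ^+ 2)%:E))//.
    by apply/measurable_EFinP; exact: measurable_funX.
  by move=> x; rewrite lee_fin sqr_ge0.
- move=> phi sphi; pose g := circle_lift phi.
  (* A periodic primitive of [g' (d x)]; the null summands give it the shape of [smooth_affine] and
     [smooth_lin]. *)
  pose h x := d%:R^-1 * g (d%:R * x + 0) + 0.
  have sg : smooth g := sphi.
  have [sgd gdE] := smooth_affine d%:R 0 sg.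
  have [sh hE] := smooth_lin d%:R^-1 sgd (@smooth_cst R 0).
  have h1 x : h (x + 1) = h x.
    rewrite /h !addr0 mulrDr mulr1; congr (_ * _).
    exact: (periodic_addz (circle_lift_periodic phi) d).
  have [sm dE] := circle_smooth_repr sh h1.
  exists (h \o @circle_repr R); split => // z.
  rewrite dE /= -derive1n1 hE gdE [derive1n 1 (fun=> 0)]derive1n1 derive1_cst addr0 expr1 mulKf//.
  by rewrite addr0 /expanding circle_deriv_proj// derive1n1.
Qed.

(** [c = 1 / d] gives the Perron-Frobenius operator, [c = 1] the derivative of the push-forward. *)
Definition transfer (c : R) (f : circle R -> R) (z : circle R) :=
  c * \sum_(k < d) f (branch d k z).

Lemma measurable_transfer c f : measurable_fun setT f -> measurable_fun setT (transfer c f).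
Proof.
move=> mf; apply: measurable_funM => //; apply: measurable_sum => k.
by apply: measurableT_comp => //; exact: measurable_branch.
Qed.

(** One factor [d] comes from Cauchy-Schwarz over the branches, the other from the mixture
    formula. *)
Lemma sqr_integral_transfer c f : measurable_fun setT f ->
  (\int[lambda]_x ((transfer c f x) ^+ 2)%:E <=
   ((c * d%:R) ^+ 2)%:E * \int[lambda]_x ((f x) ^+ 2)%:E)%E.
Proof.
move=> mf.
have mf2 : measurable_fun setT (fun x => ((f x) ^+ 2)%:E).
  by apply/measurable_EFinP; exact: measurable_funX.
have mfk k : measurable_fun setT (fun x => ((f (branch d k x)) ^+ 2)%:E).
  by apply: (measurableT_comp mf2); exact: measurable_branch.
have c0 : (0 <= (c ^+ 2 * d%:R)%:E)%E by rewrite lee_fin mulr_ge0 ?sqr_ge0.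
apply: (@le_trans _ _ (\int[lambda]_x ((c ^+ 2 * d%:R)%:E *
    (\sum_(k < d) ((f (branch d k x)) ^+ 2)%:E)))%E).
  apply: ge0_le_integral => //.
  - by move=> x _; rewrite lee_fin sqr_ge0.
  - by apply/measurable_EFinP; apply: measurable_funX; exact: measurable_transfer.
  - by apply: emeasurable_funM => //; exact: emeasurable_sum.
  - move=> x _; rewrite sumEFin -EFinM lee_fin /transfer exprMn.
    rewrite -[leRHS]mulrA.
    by rewrite ler_wpM2l ?sqr_ge0// sqr_sum_le.
rewrite ge0_integralZl//; last 2 first.
- exact: emeasurable_sum.
- by move=> x _; apply: sume_ge0 => k _; rewrite lee_fin sqr_ge0.
rewrite ge0_integral_sum//; last by move=> k x _; rewrite lee_fin sqr_ge0.
rewrite (ge0_integral_mixture (measurable_branch d)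
  (fun A => uniform_circle_branches (A := A) d_gt0) mf2).
  by rewrite muleA -EFinM (_ : (c * _) ^+ 2 = c ^+ 2 * d%:R * d%:R)//; ring.
by move=> x; rewrite lee_fin sqr_ge0.
Qed.

(* [nu] is allowed to differ from [lambda] on non-measurable sets. *)
Lemma transfer_exists (nu : probability (circle R) R) c :
  (forall A, measurable A -> nu A = lambda A) ->
  exists T : {linear L20 lambda -> L20 nu},
  (forall v, {ae nu, forall x, T v x = transfer c v x}) /\
  forall v, `|T v| ^+ 2 <= (c * d%:R) ^+ 2 * `|v| ^+ 2.
Proof.
move=> nuE; apply: L20_operator; first exact: sqr_ge0.
- exact: measurable_transfer.
- move=> a f g x; rewrite /transfer big_split/= -mulr_sumr mulrDr; congr (_ + _).
  by rewrite mulrCA.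
- move=> f mf; rewrite (eq_measure_integral lambda); last by move=> A mA _; exact: nuE.
  exact: sqr_integral_transfer.
- move=> phi sphi; pose g := circle_lift phi.
  have sg : smooth g := sphi.
  pose gk (k : 'I_d) x := g (d%:R^-1 * x + k%:R / d%:R).
  have sgk k : smooth (gk k) by exact: (smooth_affine _ _ sg).1.
  (* The chain rule gives each [gk k] a factor [1 / d], which the coefficient [c * d]
     compensates. *)
  pose h x := (c * d%:R) * (\sum_(k < d) gk k x) + 0.
  have [ss sE] := smooth_sum (index_enum 'I_d) sgk.
  have [sh hE] := smooth_lin (c * d%:R) ss (@smooth_cst R 0).
  have h1 x : h (x + 1) = h x.
    have gkE y : \sum_(k < d) gk k y = \sum_(k < d) g ((y + k%:R) / d%:R).
      by apply: eq_bigr => k _; rewrite /gk mulrDl mulrC.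
    by rewrite /h !gkE branch_sum_periodic//; exact: circle_lift_periodic.
  have [sm dE] := circle_smooth_repr sh h1.
  exists (h \o @circle_repr R); split => // z.
  rewrite dE /= -derive1n1 hE [derive1n 1 (fun=> 0)]derive1n1 derive1_cst addr0 derive1n1 sE.
  rewrite /transfer -mulrA; congr (_ * _); rewrite mulr_sumr; apply: eq_bigr => k _.
  rewrite /branch circle_deriv_proj// -[derive1 (gk k)]derive1n1.
  rewrite /gk (smooth_affine _ _ sg).2 expr1 mulrA mulfV// mul1r derive1n1.
  by rewrite mulrDl mulrC.
Qed.

End Operators.

Lemma integrable_mul_sqr {d} {T : measurableType d} {R : realType}
    (mu : {measure set T -> \bar R}) (f g : T -> R) :
  measurable_fun setT f -> measurable_fun setT g ->
  (\int[mu]_x ((f x) ^+ 2)%:E < +oo)%E -> (\int[mu]_x ((g x) ^+ 2)%:E < +oo)%E ->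
  mu.-integrable setT (EFin \o (fun x => f x * g x)).
Proof.
have L (h : T -> R) : measurable_fun setT h -> (\int[mu]_x ((h x) ^+ 2)%:E < +oo)%E ->
    h \in Lfun mu 2%:E.
  move=> mh fin; rewrite inE; apply/andP; split; rewrite inE//= /finite_norm.
  by rewrite (@lty_poweRy _ _ 2)//; rewrite sqr_Lnorm2.
move=> mf mg ff fg; apply/Lfun1_integrable.
by apply: (@Lfun2_mul_Lfun1 _ _ _ mu f g); exact: L.
Qed.

(** * Adjointness, left inverse and kernel of the transfer operator *)

Section PerronFrobenius.
Context {R : realType} (d : nat) (d_gt0 : (0 < d)%N).
Local Notation lambda := (uniform_circle R).
Let dR0 : d%:R != 0 :> R. Proof. by rewrite pnatr_eq0 -lt0n. Qed.

(** The preimages of a null set under the branches have measures that are nonnegative and add up to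
    0. *)
Lemma ae_branch (Q : circle R -> Prop) k : (k < d)%N ->
  {ae lambda, forall x, Q x} -> {ae lambda, forall x, Q (branch d k x)}.
Proof.
move=> kd [A [mA A0 QA]].
have mB : measurable (@branch R d k @^-1` A).
  by rewrite -[X in measurable X]setTI; exact: measurable_branch.
exists (branch d k @^-1` A); split => //; last by move=> x /= nQ; exact: QA.
have := uniform_circle_branches d_gt0 mA.
rewrite [X in (_ = _ * X)%E]A0 mule0 (bigD1 (Ordinal kd))//= => /eqP.
by rewrite padde_eq0 ?sume_ge0// => /andP[/eqP].
Qed.

Lemma ae_branches (Q : circle R -> Prop) :
  {ae lambda, forall x, Q x} -> {ae lambda, forall x, forall k : 'I_d, Q (branch d k x)}.
Proof. by move=> Qx; apply: filter_forall => k; exact: ae_branch. Qed.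

Lemma sqr_integral_L2 (mu : {measure set (circle R) -> \bar R}) (v : L2 mu) :
  (\int[mu]_x ((v x) ^+ 2)%:E < +oo)%E.
Proof. by rewrite -L2_normE ltry. Qed.

Lemma eq_Rintegral_ae (f g : circle R -> R) :
  measurable_fun setT f -> measurable_fun setT g ->
  {ae lambda, forall x, f x = g x} -> \int[lambda]_x f x = \int[lambda]_x g x.
Proof.
move=> mf mg fg; rewrite /Rintegral; congr fine; apply: ae_eq_integral => //.
- exact/measurable_EFinP.
- exact/measurable_EFinP.
- by apply: filterS fg => x ->.
Qed.

(** Along every branch [u \o expanding d] is [u], so [transfer v * u] is the mean over the branches
    of [v * (u \o expanding d)]; the mixture formula integrates this mean. *)
Lemma transfer_adjoint (K P : {linear L20 lambda -> L20 lambda}) :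
  koopman d K -> (forall v, {ae lambda, forall x, P v x = transfer d d%:R^-1 v x}) ->
  forall u v, L20_inner (P v) u = L20_inner v (K u).
Proof.
move=> KE PE u v; rewrite /L20_inner.
pose h x := v x * u (expanding d x).
have muE : measurable_fun setT (fun x => (u : L2 lambda) (expanding d x)).
  by apply: measurableT_comp => //; exact: measurable_expanding.
have ih : lambda.-integrable setT (EFin \o h).
  apply: integrable_mul_sqr => //; first exact: sqr_integral_L2.
  rewrite (ge0_integral_expanding d_gt0 (f := fun x => ((u x) ^+ 2)%:E)).
  - exact: sqr_integral_L2.
  - by apply/measurable_EFinP; exact: measurable_funX.
  - by move=> x; rewrite lee_fin sqr_ge0.
have mh : measurable_fun setT h by exact: measurable_funM.
have bm (A : set (circle R)) (mA : measurable A) := uniform_circle_branches (A := A) d_gt0 mA.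
have mb := @measurable_branch R d.
rewrite [RHS](eq_Rintegral_ae (g := h)) => //; last 2 first.
- by apply: measurable_funM => //; exact: L2_measurable.
- by apply: filterS (KE u) => x ->.
rewrite (eq_Rintegral_ae (g := fun x => transfer d d%:R^-1 v x * u x)); last 3 first.
- by apply: measurable_funM => //; exact: L2_measurable.
- by apply: measurable_funM => //; exact: measurable_transfer.
- by apply: filterS (PE v) => x ->.
apply: (mulfI dR0); rewrite -(Rintegral_mixture mb bm ih).
pose F (k : 'I_d) x := (h (branch d k x))%:E.
have iF k : lambda.-integrable setT (F k).
  exact: (integrable_mixture (f := h) mb bm (ltn_ord k) ih).
transitivity (fine (\int[lambda]_x (\sum_(k < d) F k x))%E).
  rewrite -RintegralZl//; last first.
    have -> : EFin \o (fun x => transfer d d%:R^-1 v x * u x) =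
        fun x => (d%:R^-1%:E * (\sum_(k < d) F k x))%E.
      apply/funext => x; rewrite /F /= sumEFin -EFinM; congr (_%:E).
      rewrite /transfer -mulrA; congr (_ * _); rewrite mulr_suml.
      by apply: eq_bigr => k _; rewrite /h expanding_branch.
    by apply: integrableZl => //; apply: integrable_sum.
  rewrite /Rintegral; congr fine; apply: eq_integral => x _.
  rewrite /F sumEFin; congr (_%:E); rewrite /transfer !mulrA mulfV// mul1r mulr_suml.
  by apply: eq_bigr => k _; rewrite /h expanding_branch.
rewrite integral_sum// -sum_fine//.
by move=> k _; exact: integrable_fin_num (iF k).
Qed.

Lemma transfer_koopman (K P : {linear L20 lambda -> L20 lambda}) :
  koopman d K -> (forall v, {ae lambda, forall x, P v x = transfer d d%:R^-1 v x}) ->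
  cancel K P.
Proof.
move=> KE PE u; apply: val_inj; apply/L2_eqP.
move: (PE (K u)) (ae_branches (KE u)); apply: filterS2 => x -> H.
rewrite /transfer (eq_bigr (fun=> (u : L2 lambda) x)) ?sumr_const ?card_ord; last first.
  by move=> k _; rewrite H expanding_branch.
by rewrite -[X in _ * X]mulr_natl mulKf.
Qed.

Lemma transfer_kernel (P : {linear L20 lambda -> L20 lambda}) (v : L20 lambda) (f : circle R -> R) :
  (forall v, {ae lambda, forall x, P v x = transfer d d%:R^-1 v x}) ->
  {ae lambda, forall x, v x = f x} -> (forall x, transfer d 1 f x = 0) -> P v = 0.
Proof.
move=> PE vf f0; apply: val_inj; apply/L2_eqP.
have H0 : {ae lambda, forall x, (0 : L2 lambda) x = 0}.
  by have := L2_scaleE 0 (0 : L2 lambda); rewrite scale0r; apply: filterS => x ->; rewrite mul0r.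
move: (PE v) (ae_branches vf) H0; apply: filterS3 => x -> H ->.
rewrite /transfer (eq_bigr _ (fun k _ => H k)).
by have := f0 x; rewrite /transfer mul1r => ->; rewrite mulr0.
Qed.

End PerronFrobenius.

(** Completeness, stated for absolutely summable series since Neumann series are of this kind. *)
Definition abs_summable_cvg {R : realType} (V : normedModType R) :=
  forall (f : nat -> V) (C : R), (forall n, \sum_(k < n) `|f k| <= C) ->
  exists s : V, (fun n => \sum_(k < n) f k) @ \oo --> s.

(** * Completeness of [L2] and [L20] *)

Section RieszFischer.
Context {d : measure_display} {T : measurableType d} {R : realType}.
Variable mu : {measure set T -> \bar R}.

Lemma ler_norm_sum_diff (V : normedModType R) (f : nat -> V) m n :
  `|\sum_(k < m + n) f k - \sum_(k < n) f k| <= \sum_(k < m + n) `|f k| - \sum_(k < n) `|f k|.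
Proof.
elim: m => [|m IH]; first by rewrite !subrr normr0.
rewrite addSn !big_ord_recr/= ![_ + _ - _]addrAC.
by apply: (le_trans (ler_normD _ _)); rewrite lerD2r.
Qed.

Lemma fatou_bound (f : nat -> T -> \bar R) (g : T -> \bar R) (D : \bar R) :
  (forall n, measurable_fun setT (f n)) -> (forall n x, 0 <= f n x)%E ->
  (forall x, f n x @[n --> \oo] --> g x) ->
  (forall n, \int[mu]_x f n x <= D)%E -> (\int[mu]_x g x <= D)%E.
Proof.
move=> mf f0 fg fD.
rewrite (eq_integral (fun x => limn_einf (f ^~ x))); last first.
  by move=> x _; rewrite (cvg_limn_einf_sup (fg x)).1.
apply: (le_trans (fatou mu measurableT mf _)) => //.
rewrite limn_einf_lim; apply: lime_le; first exact: is_cvg_einfs.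
apply: nearW => n; apply: (le_trans _ (fD n)).
by apply: ereal_inf_lbound; exists n => /=.
Qed.

Lemma L2_sumE (I : Type) (r : seq I) (f : I -> L2 mu) :
  {ae mu, forall x, (\sum_(k <- r) f k : L2 mu) x = \sum_(k <- r) f k x}.
Proof.
elim: r => [|k r IH].
  rewrite big_nil; have := L2_scaleE 0 (0 : L2 mu); rewrite scale0r.
  by apply: filterS => x ->; rewrite mul0r big_nil.
rewrite big_cons; move: (L2_addE (f k) (\sum_(j <- r) f j)) IH.
by apply: filterS2 => x -> ->; rewrite big_cons.
Qed.

Lemma L2_abs (v : L2 mu) : exists w : L2 mu, {ae mu, forall x, w x = `|v x|} /\ `|w| = `|v|.
Proof.
have mv : measurable_fun setT (fun x => `|v x|).
  by apply: measurableT_comp => //; exact: L2_measurable.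
have E : (\int[mu]_x (`|v x| ^+ 2)%:E = (`|v| ^+ 2)%:E)%E.
  by rewrite L2_normE; apply: eq_integral => x _; rewrite -normrX ger0_norm ?sqr_ge0.
have [|w wE] := L2_of_sqr_integrable (mu := mu) mv; first by rewrite E ltry.
exists w; split => //; apply/eqP; rewrite -(@eqrXn2 _ 2)//.
by have := L2_norm_ae mv wE; rewrite E => -[->].
Qed.

(** The Riesz-Fischer argument: by Fatou, the sum of the [|f k|] is square integrable, hence finite
    almost everywhere, and there the series converges absolutely. *)
Lemma L2_abs_summable_cvg (f : nat -> L2 mu) (C : R) :
  (forall n, \sum_(k < n) `|f k| <= C) ->
  exists s : L2 mu, (fun n => \sum_(k < n) f k) @ \oo --> s.
Proof.
move=> fC.
pose G n (x : T) : R := \sum_(k < n) `|f k x|.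
have mabs k : measurable_fun setT (fun x => `|f k x|).
  by apply: measurableT_comp => //; exact: L2_measurable.
have mG n : measurable_fun setT (G n) by apply: measurable_sum => k; exact: mabs.
have G0 n x : 0 <= G n x by apply: sumr_ge0.
have Gnd x : nondecreasing_seq (G ^~ x).
  by apply/nondecreasing_seqP => n; rewrite /G big_ord_recr/= lerDl.
have C0 : 0 <= C by have := fC 0%N; rewrite big_ord0.
have intG n : (\int[mu]_x ((G n x) ^+ 2)%:E <= (C ^+ 2)%:E)%E.
  have [a aE] := choice (fun k => L2_abs (f k)).
  have aeG : {ae mu, forall x, (\sum_(k < n) a k : L2 mu) x = G n x}.
    have : {ae mu, forall x, forall k : 'I_n, a k x = `|f k x|}.
      by apply: filter_forall => k; exact: (aE k).1.
    have := L2_sumE (index_enum 'I_n) a; apply: filterS2 => x -> H.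
    by apply: eq_bigr => k _; rewrite H.
  rewrite -(L2_norm_ae (mG n) aeG) lee_fin ler_pXn2r ?nnegrE//.
  apply: (le_trans (ler_norm_sum _ _ _)); apply: le_trans (fC n).
  by apply: ler_sum => k _; rewrite (aE k).2.
pose F n x : \bar R := ((G n x) ^+ 2)%:E.
have mF n : measurable_fun setT (F n) by apply/measurable_EFinP; exact: measurable_funX.
have F0 n x : (0 <= F n x)%E by rewrite lee_fin sqr_ge0.
have Fcvg x : F n x @[n --> \oo] --> limn (F ^~ x).
  apply: ereal_nondecreasing_is_cvgn => n m nm.
  by rewrite lee_fin ler_pXn2r ?nnegrE//; exact: Gnd.
pose Fl (x : T) : \bar R := limn (F ^~ x).
have mFl : measurable_fun setT Fl.
  exact: (@emeasurable_fun_cvg _ _ _ setT F Fl mF (fun x _ => Fcvg x)).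
have Fl0 x : (0 <= Fl x)%E by apply: lime_ge; [exact: Fcvg|exact: nearW].
have iFl : mu.-integrable setT Fl.
  apply/integrableP; split => //.
  rewrite (eq_integral Fl); last by move=> x _; rewrite gee0_abs.
  by apply: (le_lt_trans (fatou_bound mF F0 Fcvg intG)); rewrite ltry.
pose E := [set x | Fl x \is a fin_num].
have mE : measurable E.
  by rewrite -[E]setTI; exact: emeasurable_fin_num.
have aeE : {ae mu, forall x, E x}.
  by apply: filterS (integrable_ae measurableT iFl) => x; exact.
(* Cutting by the indicator of [E] makes the partial sums converge at every point, so that their
   limit is measurable. *)
pose h n (x : T) : R := \1_E x * \sum_(k < n) f k x.
have mh n : measurable_fun setT (h n).
  apply: measurable_funM; first exact: measurable_indic.
  by apply: measurable_sum => k; exact: L2_measurable.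
have hcvg x : cvgn (h ^~ x).
  rewrite /h; have [Ex|nEx] := pselect (E x); last first.
    by rewrite indicE memNset//; under eq_fun do rewrite mul0r; exact: is_cvg_cst.
  rewrite indicE mem_set//; under eq_fun do rewrite mul1r.
  rewrite (_ : (fun n => _) = series (fun k => f k x)); last first.
    by apply/funext => n; rewrite seriesEord.
  apply: normed_cvg; rewrite /normed_series_of.
  rewrite (_ : series _ = G ^~ x); last by apply/funext => n; rewrite seriesEord.
  apply: nondecreasing_is_cvgn => //.
  exists (fine (Fl x) + 1) => _ [n _ <-].
  have : (F n x <= Fl x)%E.
    apply: lime_ge; first exact: Fcvg.
    exists n => // m /= nm.
    by rewrite lee_fin ler_pXn2r ?nnegrE//; exact: Gnd.
  rewrite -(fineK Ex) lee_fin.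
  have : G n x <= (G n x) ^+ 2 + 1.
    by have := sqr_ge0 (G n x - 2^-1); rewrite sqrrB -[in 2^-1 ^+ 2]div1r; nra.
  lra.
pose s (x : T) : R := limn (h ^~ x).
have ms : measurable_fun setT s by apply: (measurable_fun_cvg mh) => x _; exact: hcvg.
pose Tn n := \sum_(k < n) `|f k|.
have Tnd : nondecreasing_seq Tn.
  by apply/nondecreasing_seqP => n; rewrite /Tn big_ord_recr/= lerDl.
have Tcvg : cvgn Tn.
  by apply: nondecreasing_is_cvgn => //; exists C => _ [n _ <-]; exact: fC.
pose TT := limn Tn.
have TnT n : Tn n <= TT by exact: nondecreasing_cvgn_le.
pose P n : L2 mu := \sum_(k < n) f k.
have PE n : {ae mu, forall x, P n x = h n x}.
  have := L2_sumE (index_enum 'I_n) (fun k : 'I_n => f k); move: aeE.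
  by apply: filterS2 => x Ex ->; rewrite /h indicE mem_set// mul1r.
(* Fatou applied to the tails: the norm of a tail is at most the tail of the norms. *)
have diff n : (\int[mu]_x ((s x - h n x) ^+ 2)%:E <= ((TT - Tn n) ^+ 2)%:E)%E.
  apply: (@fatou_bound (fun m x => ((h (m + n)%N x - h n x) ^+ 2)%:E)).
  - by move=> m; apply/measurable_EFinP; apply: measurable_funX; exact: measurable_funB.
  - by move=> m x; rewrite lee_fin sqr_ge0.
  - move=> x; apply: cvg_EFin; first exact: nearW.
    rewrite (_ : fine \o _ = fun m => (h (m + n)%N x - h n x) ^+ 2)//.
    under eq_fun do rewrite expr2.
    have H : h (m + n)%N x - h n x @[m --> \oo] --> s x - h n x.
      apply: cvgB; last exact: cvg_cst.
      by rewrite (cvg_shiftn n (h ^~ x)); exact: hcvg.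
    by rewrite expr2; exact: cvgM.
  - move=> m.
    have : {ae mu, forall x, (P (m + n)%N - P n : L2 mu) x = h (m + n)%N x - h n x}.
      move: (L2_subE (P (m + n)%N) (P n)) (PE (m + n)%N) (PE n).
      by apply: filterS3 => x -> -> ->.
    move/(L2_norm_ae (measurable_funB (mh _) (mh _))) => <-.
    rewrite lee_fin ler_pXn2r ?nnegrE ?subr_ge0//.
    apply: (@le_trans _ _ (Tn (m + n)%N - Tn n)); last by rewrite lerD2r.
    exact: (ler_norm_sum_diff f).
have [|w wE] := L2_of_sqr_integrable (mu := mu) ms.
  (* Since [h 0] is null, the tail estimate at 0 is the square integrability of [s]. *)
  apply: le_lt_trans (ltry ((TT - Tn 0%N) ^+ 2)); apply: le_trans (diff 0%N).
  rewrite le_eqVlt; apply/orP; left; apply/eqP; apply: eq_integral => x _.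
  by rewrite /h big_ord0 mulr0 subr0.
exists w; apply/cvgrPdist_le => e e0.
have /cvgrPdist_le/(_ e e0) := Tcvg; apply: filterS => n.
rewrite -/TT ger0_norm ?subr_ge0//; apply: le_trans.
rewrite -(@ler_pXn2r _ 2)// ?nnegrE ?subr_ge0// -lee_fin.
apply: le_trans (diff n).
have H : {ae mu, forall x, (w - P n : L2 mu) x = s x - h n x}.
  by move: (L2_subE w (P n)) wE (PE n); apply: filterS3 => x -> -> ->.
by rewrite (L2_norm_ae (measurable_funB ms (mh n)) H).
Qed.

End RieszFischer.

Lemma L20_abs_summable_cvg {R : realType} (mu : probability (circle R) R) :
  abs_summable_cvg (L20 mu).
Proof.
move=> f C fC.
have valS n : L20_val (\sum_(k < n) f k) = \sum_(k < n) L20_val (f k).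
  by elim: n => [|n IH]; rewrite ?big_ord0// !big_ord_recr/= -IH.
have [s sl] := @L2_abs_summable_cvg _ _ _ mu (fun k => L20_val (f k)) C fC.
have sP : s \in @L20_pred R mu.
  rewrite inE; apply/closure_normP => e e0.
  move/cvgrPdist_lt : sl => /(_ (e / 2)) [|n _ /(_ n (leqnn n)) sn]; first by rewrite divr_gt0.
  have := L20_valP (\sum_(k < n) f k); rewrite inE => /closure_normP/(_ (e / 2)) [|t St vt].
    by rewrite divr_gt0.
  exists t => //; rewrite [e]splitr -[s](subrK (L20_val (\sum_(k < n) f k))) -addrA.
  by apply: (le_lt_trans (ler_normD _ _)); apply: ltrD => //; rewrite valS.
exists (MkL20 sP); apply/cvgrPdist_lt => e e0.
by move/cvgrPdist_lt : sl => /(_ e e0); apply: filterS => n; rewrite -valS.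
Qed.

Lemma bounded_continuous {R : realType} (V V' : normedModType R) (f : {linear V -> V'}) (C : R) :
  (forall u, `|f u| <= C * `|u|) -> continuous f.
Proof.
move=> fC; apply/bounded_linear_continuous/linear_boundedP.
apply: filterS (nbhs_pinfty_ge (num_real C)) => r Cr x.
by apply: (le_trans (fC x)); rewrite ler_wpM2r.
Qed.

(** * Neumann series on the complexification *)

Section Neumann.
Context {R : realType} {V : normedModType R}.
Hypothesis V_complete : abs_summable_cvg V.
Local Notation W := (complexification V).

(** The norm of [R[i]] takes its values in [R[i]]; the estimates compare real numbers. *)
Definition cmod (z : R[i]) : R := complex.Re `|z|.

Lemma normr_cmod (z : R[i]) : `|z| = ((cmod z)%:C)%C.
Proof. by rewrite /cmod normc_def. Qed.

Lemma cmodM (a b : R[i]) : cmod (a * b) = cmod a * cmod b.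
Proof.
by apply: complexI; rewrite rmorphM/= -!normr_cmod normrM.
Qed.

Lemma cmod_ge0 (z : R[i]) : 0 <= cmod z.
Proof. by rewrite /cmod normc_def/= sqrtr_ge0. Qed.

Lemma cmod1 : cmod 1 = 1.
Proof. by rewrite /cmod normr1. Qed.

Lemma cmodX (z : R[i]) n : cmod (z ^+ n) = cmod z ^+ n.
Proof. by elim: n => [|n IH]; rewrite ?cmod1// !exprS cmodM IH. Qed.

Lemma normRe_cmod (z : R[i]) : `|complex.Re z| <= cmod z.
Proof.
rewrite /cmod normc_def/= -(@ler_pXn2r _ 2)// ?nnegrE ?sqrtr_ge0//.
by rewrite sqr_sqrtr ?addr_ge0 ?sqr_ge0// -normrX ger0_norm ?sqr_ge0// lerDl sqr_ge0.
Qed.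

Lemma normIm_cmod (z : R[i]) : `|complex.Im z| <= cmod z.
Proof.
rewrite /cmod normc_def/= -(@ler_pXn2r _ 2)// ?nnegrE ?sqrtr_ge0//.
by rewrite sqr_sqrtr ?addr_ge0 ?sqr_ge0// -normrX ger0_norm ?sqr_ge0// lerDr sqr_ge0.
Qed.

(** Exactly homogeneous for real scalars ([cnormZr]), but only up to a factor 2 for complex ones
    ([cnormZ]). *)
Definition cnorm (w : W) : R := `|w.1| + `|w.2|.

Lemma cnorm_ge0 w : 0 <= cnorm w. Proof. by rewrite addr_ge0. Qed.

Lemma cnormD w w' : cnorm (w + w') <= cnorm w + cnorm w'.
Proof. by rewrite /cnorm addrACA; apply: lerD; exact: ler_normD. Qed.

Lemma cnormZ z w : cnorm (z *: w) <= 2 * cmod z * cnorm w.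
Proof.
have h (a b : R) (u v : V) : `|a| <= cmod z -> `|b| <= cmod z ->
    `|a *: u + b *: v| <= cmod z * (`|u| + `|v|).
  move=> az bz; apply: (le_trans (ler_normD _ _)).
  by rewrite !normrZ mulrDr; apply: lerD; rewrite ler_wpM2r.
have h1 := h (complex.Re z) (- complex.Im z) w.1 w.2 (normRe_cmod z).
have h2 := h (complex.Re z) (complex.Im z) w.2 w.1 (normRe_cmod z) (normIm_cmod z).
rewrite normrN scaleNr in h1; have {}h1 := h1 (normIm_cmod z).
apply: (@le_trans _ _ (cmod z * (`|w.1| + `|w.2|) + cmod z * (`|w.2| + `|w.1|))).
  exact: lerD.
by rewrite /cnorm; lra.
Qed.

Variable A : {linear V -> V}.
Hypothesis A_contract : forall u, `|A u| <= `|u|.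

Lemma complexifyZ z w : complexify A (z *: w) = z *: complexify A w.
Proof. by congr pair; rewrite /= ?linearB ?linearD/= !linearZ. Qed.

Lemma complexifyD w w' : complexify A (w + w') = complexify A w + complexify A w'.
Proof. by congr pair; rewrite /= linearD. Qed.

Lemma cnorm_iter n w : cnorm (iter n (complexify A) w) <= cnorm w.
Proof.
by elim: n => //= n; apply: le_trans; apply: lerD; exact: A_contract.
Qed.

Lemma iter_scale_complexify z n w :
  iter n (fun s => z *: complexify A s) w = z ^+ n *: iter n (complexify A) w.
Proof.
by elim: n => [|n IH] /=; rewrite ?scale1r// IH complexifyZ scalerA exprS.
Qed.

(** Pulling out [z ^+ n] before estimating pays the factor 2 of [cnormZ] once. Estimating each step
    would give [(2 * cmod z) ^+ n], which need not tend to 0. *)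
Lemma cnorm_iter_scale z n w :
  cnorm (iter n (fun s => z *: complexify A s) w) <= 2 * cmod z ^+ n * cnorm w.
Proof.
rewrite iter_scale_complexify; apply: (le_trans (cnormZ _ _)); rewrite cmodX.
by rewrite ler_wpM2l ?cnorm_iter// mulr_ge0// exprn_ge0// cmod_ge0.
Qed.

Lemma geometric_sum_le (q : R) n : 0 <= q < 1 -> \sum_(k < n) q ^+ k <= (1 - q)^-1.
Proof.
move=> /andP[q0 q1]; have q1' : 0 < 1 - q by rewrite subr_gt0.
rewrite -[leRHS]mul1r ler_pdivlMr// mulrC.
have := subrX1 q n; have := exprn_ge0 n q0; move: (q ^+ n) (\sum_(_ < n) _) => a b; nra.
Qed.

Lemma neumann_expand z w s n : s = w + z *: complexify A s ->
  s = \sum_(k < n) iter k (fun s => z *: complexify A s) w + iter n (fun s => z *: complexify A s) s.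
Proof.
move=> sE; have iterD k u v : iter k (fun s => z *: complexify A s) (u + v) =
    iter k (fun s => z *: complexify A s) u + iter k (fun s => z *: complexify A s) v.
  by elim: k => //= k ->; rewrite complexifyD scalerDr.
elim: n => [|n IH]; first by rewrite big_ord0 add0r.
by rewrite big_ord_recr -addrA iterSr -iterD -sE.
Qed.

Lemma cnorm_sum (n : nat) (f : nat -> W) : cnorm (\sum_(k < n) f k) <= \sum_(k < n) cnorm (f k).
Proof.
elim: n => [|n IH]; first by rewrite !big_ord0 /cnorm/= normr0 addr0.
by rewrite !big_ord_recr/=; apply: (le_trans (cnormD _ _)); rewrite lerD2r.
Qed.

Lemma cnorm_neumann_sum n z w : cmod z < 1 ->
  \sum_(k < n) cnorm (iter k (fun s => z *: complexify A s) w) <= 2 * (1 - cmod z)^-1 * cnorm w.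
Proof.
move=> z1; apply: (@le_trans _ _ (\sum_(k < n) (2 * cnorm w) * cmod z ^+ k)).
  by apply: ler_sum => k _; rewrite mulrAC; exact: cnorm_iter_scale.
rewrite -mulr_sumr [leRHS]mulrAC ler_wpM2l ?mulr_ge0 ?cnorm_ge0//.
by apply: geometric_sum_le; rewrite cmod_ge0.
Qed.

(** An a priori bound for any solution. Applied to differences of solutions, it yields both
    uniqueness and the continuity of the resolvent. *)
Lemma neumann_bound z w s : cmod z < 1 -> s = w + z *: complexify A s ->
  cnorm s <= 2 * (1 - cmod z)^-1 * cnorm w.
Proof.
move=> z1 sE; apply/ler_addgt0Pr => e e0.
have c0 : 0 < 2 * cnorm s + 1 by rewrite ltr_wpDl// mulr_ge0// cnorm_ge0.
have : `|cmod z| < 1 by rewrite ger0_norm ?cmod_ge0.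
(* [n] is taken so large that the remainder, at most [2 * cmod z ^+ n * cnorm s], is below [e]; the
   added 1 covers [s = 0]. *)
move=> /cvg_expr/cvgrPdist_lt/(_ (e / (2 * cnorm s + 1))) [|n _ /(_ n (leqnn n))]; first exact: divr_gt0.
rewrite sub0r normrN ger0_norm ?exprn_ge0 ?cmod_ge0// ltr_pdivlMr// => qn.
rewrite {1}(neumann_expand n sE); apply: (le_trans (cnormD _ _)); apply: lerD.
  by apply: (le_trans (cnorm_sum _ _)); exact: cnorm_neumann_sum.
apply: (le_trans (cnorm_iter_scale _ _ _)).
have := exprn_ge0 n (cmod_ge0 z); move: qn; move: (cmod z ^+ n) => q; nra.
Qed.

(** The partial sums satisfy [S (n + 1) = w + z A (S n)]. This recursion is passed to the limit in
    each component, where the completeness of [V] applies. *)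
Lemma neumann_exists z w : cmod z < 1 -> exists s, s = w + z *: complexify A s.
Proof.
move=> z1; pose F k : W := iter k (fun s => z *: complexify A s) w.
have [s1 s1l] : exists s1 : V, (fun n => \sum_(k < n) (F k).1) @ \oo --> s1.
  apply: (V_complete (f := fun k => (F k).1) (C := 2 * (1 - cmod z)^-1 * cnorm w)) => n.
  apply: (le_trans _ (cnorm_neumann_sum n w z1)).
  by apply: ler_sum => k _; rewrite lerDl.
have [s2 s2l] : exists s2 : V, (fun n => \sum_(k < n) (F k).2) @ \oo --> s2.
  apply: (V_complete (f := fun k => (F k).2) (C := 2 * (1 - cmod z)^-1 * cnorm w)) => n.
  apply: (le_trans _ (cnorm_neumann_sum n w z1)).
  by apply: ler_sum => k _; rewrite lerDr.
pose S n : W := \sum_(k < n) F k.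
have SE n : S n = (\sum_(k < n) (F k).1, \sum_(k < n) (F k).2).
  by rewrite /S; elim: n => [|n IH]; rewrite ?big_ord0// !big_ord_recr/= IH.
have Srec n : S n.+1 = w + z *: complexify A (S n).
  rewrite /S; elim: n => [|n IH].
    rewrite big_ord_recr !big_ord0/= add0r.
    rewrite (_ : complexify A 0 = 0) ?scaler0 ?addr0//.
    by congr pair; rewrite /= linear0.
  rewrite big_ord_recr IH/= -addrA; congr (_ + _).
  by rewrite -scalerDr -complexifyD -IH big_ord_recr.
have cA : continuous A.
  by apply: (@bounded_continuous _ _ _ A 1) => u; rewrite mul1r.
exists ((s1, s2) : W).
have r1 n : \sum_(k < n.+1) (F k).1 =
    w.1 + (complex.Re z *: A (\sum_(k < n) (F k).1) - complex.Im z *: A (\sum_(k < n) (F k).2)).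
  by have := congr1 fst (Srec n); rewrite !SE.
have r2 n : \sum_(k < n.+1) (F k).2 =
    w.2 + (complex.Re z *: A (\sum_(k < n) (F k).2) + complex.Im z *: A (\sum_(k < n) (F k).1)).
  by have := congr1 snd (Srec n); rewrite !SE.
have A1 : A (\sum_(k < n) (F k).1) @[n --> \oo] --> A s1.
  by apply: continuous_cvg s1l; exact: cA.
have A2 : A (\sum_(k < n) (F k).2) @[n --> \oo] --> A s2.
  by apply: continuous_cvg s2l; exact: cA.
congr pair.
- have l1 : (fun n => \sum_(k < n.+1) (F k).1) @ \oo --> s1.
    by rewrite (cvg_shiftS (fun n => \sum_(k < n) (F k).1)).
  apply: (cvg_unique _ l1) => //.
  rewrite (funext r1); apply: cvgD; first exact: cvg_cst.
  by apply: cvgB; apply: cvgZr.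
- have l2 : (fun n => \sum_(k < n.+1) (F k).2) @ \oo --> s2.
    by rewrite (cvg_shiftS (fun n => \sum_(k < n) (F k).2)).
  apply: (cvg_unique _ l2) => //.
  rewrite (funext r2); apply: cvgD; first exact: cvg_cst.
  by apply: cvgD; apply: cvgZr.
Qed.

End Neumann.

(** * Resolvent set, eigenvectors and boundary of the spectrum *)

Section Spectral.
Context {R : realType} {V : normedModType R}.
Hypothesis V_complete : abs_summable_cvg V.
Local Notation W := (complexification V).
Variables (d : nat) (P K : {linear V -> V}).
Hypotheses (d_gt0 : (0 < d)%N) (PK : cancel K P).
Hypotheses (P_contract : forall u, `|P u| <= `|u|) (K_contract : forall u, `|K u| <= `|u|).
Local Notation T := (d%:R \*: P).

Let dR0 : d%:R != 0 :> R[i]. Proof. by rewrite pnatr_eq0 -lt0n. Qed.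
Let dR_gt0 : 0 < d%:R :> R. Proof. by rewrite ltr0n. Qed.

Lemma cmod_nat n : cmod (n%:R : R[i]) = n%:R.
Proof. by rewrite /cmod normr_nat -(rmorph_nat (real_complex R)). Qed.

Lemma cmodV (z : R[i]) : cmod z^-1 = (cmod z)^-1.
Proof. by apply: complexI; rewrite fmorphV/= -!normr_cmod normfV. Qed.

Lemma complexify_scaled w : complexify T w = d%:R *: complexify P w.
Proof.
rewrite -(rmorph_nat (real_complex R)).
by congr pair; rewrite /= scale0r ?subr0 ?addr0.
Qed.

Lemma cnorm_eq0 (w : W) : cnorm w = 0 -> w = 0.
Proof.
case: w => u v /eqP; rewrite /cnorm/= paddr_eq0//= !normr_eq0.
by move=> /andP[/eqP -> /eqP ->].
Qed.

Lemma cnormZr (r : R) (w : W) : cnorm ((r%:C)%C *: w) = `|r| * cnorm w.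
Proof. by rewrite /cnorm /= !scale0r subr0 addr0 !normrZ mulrDr. Qed.

(** The complexification has only the topology of [V * V]; the proof moves to that product, whose
    max norm is comparable with [cnorm]. *)
Lemma bounded_complex_continuous (S : W -> W) (C : R) : 0 < C ->
  (forall y y', cnorm (S y - S y') <= C * cnorm (y - y')) -> continuous S.
Proof.
move=> C0 SC; have : continuous (S : (V * V)%type -> (V * V)%type).
  move=> y; apply/cvgrPdist_le => e e0.
  have e1 : 0 < e / (2 * C) by rewrite divr_gt0// mulr_gt0.
  have : \forall y' \near nbhs y, `|y.1 - y'.1| <= e / (2 * C) /\ `|y.2 - y'.2| <= e / (2 * C).
    exists ([set u | `|y.1 - u| <= e / (2 * C)], [set u | `|y.2 - u| <= e / (2 * C)]) => //=.
    by split; apply/nbhs_ballP; exists (e / (2 * C)) => // u; rewrite -ball_normE => /ltW.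
  apply: filterS => y' [y1 y2].
  apply: (@le_trans _ _ (cnorm (S y - S y'))).
    by rewrite prod_normE/= ge_max /cnorm lerDl lerDr !normr_ge0.
  apply: (le_trans (SC _ _)); rewrite mulrC -ler_pdivlMr//.
  rewrite /cnorm; apply: (le_trans (lerD y1 y2)).
  by rewrite le_eqVlt; apply/orP; left; apply/eqP; field; rewrite gt_eqF.
exact.
Qed.

Lemma continuous_complex_bounded (S : W -> W) : continuous S -> S 0 = 0 ->
  exists2 e : R, 0 < e & forall y, cnorm y < e -> cnorm (S y) < 1.
Proof.
move=> cS S0; have : continuous (S : (V * V)%type -> (V * V)%type) by exact: cS.
move/(_ 0)/cvgrPdist_lt/(_ (1 / 2)) => []; first by lra.
move=> [A B] /= [/nbhs_ballP[a /= a0 aA] /nbhs_ballP[b /= b0 bB]] AB.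
exists (Num.min a b); first by rewrite lt_min a0.
move=> y; rewrite lt_min /cnorm => /andP[ya yb].
have : `|(S (0 : W) : (V * V)%type) - S y| < 1 / 2.
  apply: AB; split => /=; [apply: aA|apply: bB]; rewrite -ball_normE/= sub0r normrN.
    by apply: le_lt_trans ya; rewrite lerDl.
  by apply: le_lt_trans yb; rewrite lerDr.
by rewrite S0 sub0r normrN prod_normE gt_max => /andP[]; lra.
Qed.

Lemma resolvent (z : R[i]) : d%:R < cmod z -> ~ complex_spectrum T z.
Proof.
move=> dz nex; apply: nex.
have cz0 : 0 < cmod z by exact: lt_trans dz.
have z0 : z != 0.
  by apply: contraTneq cz0 => ->; rewrite (cmod_nat 0) ltxx.
pose q : R[i] := d%:R / z.
have q1 : cmod q < 1 by rewrite /q cmodM cmodV cmod_nat ltr_pdivrMr// mul1r.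
(* The resolvent equation becomes a fixed-point equation with coefficient [q = d / z], of modulus
   less than 1. *)
have solve s y : complexify T s - z *: s = y <-> s = - z^-1 *: y + q *: complexify P s.
  rewrite complexify_scaled; split => [<-|].
    rewrite scalerBr !scalerA !mulNr mulVf// scaleN1r opprK scaleNr /q [d%:R / z]mulrC.
    by rewrite addrAC addNr add0r.
  move=> /(congr1 (fun s => z *: s)); rewrite scalerDr !scalerA mulrN mulfV// scaleN1r.
  by rewrite /q mulrCA mulfV// mulr1 => ->; rewrite opprD opprK addrCA subrr addr0.
have [S SE] := choice (fun y => neumann_exists V_complete P_contract (- z^-1 *: y) q1).
have C0 : 0 <= 2 * (1 - cmod q)^-1.
  by rewrite mulr_ge0// invr_ge0 subr_ge0; exact: ltW.
have diff s s' y y' : s = - z^-1 *: y + q *: complexify P s ->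
    s' = - z^-1 *: y' + q *: complexify P s' ->
    cnorm (s - s') <= 2 * (1 - cmod q)^-1 * cnorm (- z^-1 *: (y - y')).
  move=> sE s'E; apply: (neumann_bound P_contract q1).
  rewrite {1}sE {1}s'E opprD addrACA -!scalerBr; congr (_ + _ *: _).
  by congr pair; rewrite /= linearB.
exists S; split.
- apply: (@bounded_complex_continuous S (2 * (1 - cmod q)^-1 * (2 * cmod (- z^-1)) + 1)).
    by rewrite ltr_wpDl// mulr_ge0// mulr_ge0// cmod_ge0.
  move=> y y'; apply: (le_trans (diff _ _ _ _ (SE y) (SE y'))).
  apply: (@le_trans _ _ (2 * (1 - cmod q)^-1 * (2 * cmod (- z^-1)) * cnorm (y - y'))).
    by rewrite -[leRHS]mulrA ler_wpM2l ?cnormZ.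
  by rewrite ler_wpM2r ?cnorm_ge0// lerDl.
- move=> w; exact/solve/SE.
- move=> w; apply/eqP; rewrite -subr_eq0; apply/eqP/cnorm_eq0.
  have wE := (solve w _).1 erefl.
  apply/eqP; rewrite eq_le cnorm_ge0 andbT.
  apply: (le_trans (diff _ _ _ _ (SE _) wE)).
  by rewrite subrr scaler0 /cnorm/= normr0 addr0 mulr0.
Qed.

Lemma eigenvector (z : R[i]) (v : W) : cmod z < d%:R -> complexify P v = 0 ->
  exists w, w = v + (z / d%:R) *: complexify K w /\ complexify P w = (z / d%:R) *: w.
Proof.
move=> zd Pv.
have q1 : cmod (z / d%:R) < 1.
  by rewrite cmodM cmodV cmod_nat ltr_pdivrMr// mul1r.
have [w wE] := neumann_exists V_complete K_contract v q1.
exists w; split => //; rewrite {1}wE complexifyD Pv add0r complexifyZ; congr (_ *: _).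
by case: (w) => a b; rewrite /complexify/= !PK.
Qed.

Lemma eigenspace_infinite_dimensional (z : R[i]) (v : nat -> W) :
  cmod z < d%:R -> (forall i, complexify P (v i) = 0) ->
  (forall n (c : 'I_n -> R[i]), \sum_i c i *: v i = 0 -> forall i, c i = 0) ->
  infinite_dimensional (complex_eigenspace T z).
Proof.
move=> zd Pv vfree n.
have [w wE] := choice (fun i => eigenvector zd (Pv i)).
exists (fun i : 'I_n => w i) => [i|c cw].
  rewrite /complex_eigenspace/= complexify_scaled (wE i).2 scalerA.
  by rewrite mulrCA mulfV// mulr1.
apply: vfree.
have complexify0 (A : {linear V -> V}) : complexify A 0 = 0.
  by congr pair; rewrite /= linear0.
(* [1 - K P] is linear and sends [w i] to [v i], so a linear relation among the [w i] is one among
   the [v i]. *)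
have vE i : v i = w i - complexify K (complexify P (w i)).
  by rewrite (wE i).2 complexifyZ {1}(wE i).1 addrK.
have sumE (A : {linear V -> V}) (f : 'I_n -> W) :
    \sum_i c i *: complexify A (f i) = complexify A (\sum_i c i *: f i).
  apply: (big_ind2 (fun a b => a = complexify A b)) => //.
  - by move=> a b a' b' -> ->; rewrite complexifyD.
  - by move=> i _; rewrite complexifyZ.
rewrite (eq_bigr (fun i : 'I_n => c i *: w i - c i *: complexify K (complexify P (w i)))).
  by rewrite sumrB cw sumE sumE cw !complexify0 subrr.
by move=> i _; rewrite {1}vE scalerBr.
Qed.

(** Shrinking [z] slightly towards 0 gives an eigenvalue [z'] with a normalized eigenvector [u]. A
    continuous inverse [S] of [T - z] would send the small vector [(z' - z) u] to [u], against
    continuity at 0. *)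
Lemma complex_spectrum_disc (z : R[i]) :
  (forall z', cmod z' < d%:R -> exists2 w, w != 0 & complexify T w = z' *: w) ->
  cmod z <= d%:R -> complex_spectrum T z.
Proof.
move=> eig zd [S [cS ST TS]].
have complexify0 (A : {linear V -> V}) : complexify A 0 = 0.
  by congr pair; rewrite /= linear0.
have S0 : S 0 = 0.
  by have := TS 0; rewrite complexify0 scaler0 subrr.
have [e e0 eS] := continuous_complex_bounded cS S0.
(* With [z' = (1 - r) z], the bound [2 * cmod (z' - z) <= 2 * r * d] is at most [e / 2], and
   [r <= 1] keeps [1 - r] nonnegative. *)
pose r : R := Num.min 1 (e / (4 * d%:R)).
have r0 : 0 < r by rewrite lt_min ltr01 divr_gt0// mulr_gt0.
have rr1 : r <= 1 by rewrite ge_min lexx.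
have re : r * (4 * d%:R) <= e by rewrite -ler_pdivlMr ?mulr_gt0// ge_min lexx orbT.
pose z' := ((1 - r)%:C)%C * z.
have cmodr (a : R) : cmod (a%:C)%C = `|a|.
  by rewrite /cmod normc_def/= expr0n/= addr0 sqrtr_sqr.
have z'd : cmod z' < d%:R.
  rewrite cmodM cmodr ger0_norm ?subr_ge0//.
  apply: (@le_lt_trans _ _ ((1 - r) * d%:R)); first by rewrite ler_wpM2l ?subr_ge0.
  by rewrite mulrBl mul1r ltrBlDr ltrDl mulr_gt0.
have [w w0 wE] := eig z' z'd.
have nw : 0 < cnorm w.
  by rewrite lt_def cnorm_ge0 andbT; apply: contra w0 => /eqP/cnorm_eq0 ->.
pose u := (((cnorm w)^-1)%:C)%C *: w.
have nu : cnorm u = 1 by rewrite cnormZr ger0_norm ?invr_ge0 ?ltW// mulVf// gt_eqF.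
have uE : complexify T u = z' *: u by rewrite /u complexifyZ wE !scalerA mulrC.
have : cnorm ((z' - z) *: u) < e.
  apply: (le_lt_trans (cnormZ _ _)); rewrite nu mulr1.
  have -> : z' - z = ((- r)%:C)%C * z.
    by rewrite /z' -[X in _ - X]mul1r -mulrBl; congr (_ * _); rewrite rmorphB/= rmorphN/= rmorph1 addrAC subrr add0r.
  rewrite cmodM cmodr normrN gtr0_norm//.
  have rz : r * cmod z <= r * d%:R by rewrite ler_wpM2l// ltW.
  by have := mulr_gt0 r0 dR_gt0; lra.
move/eS; rewrite scalerBl -uE TS nu; lra.
Qed.

End Spectral.

(** * Sines as elements of [L20], and their sums over arithmetic progressions *)

Section Trigonometric.
Context {R : realType}.
Local Notation U := (uniform_prob (@ltr01 R) : probability (measurableTypeR R) R).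
Local Notation lambda := (uniform_circle R).
Local Notation twopi := (pi *+ 2 : R).

Lemma uniform_circle_atomless : atomless lambda.
Proof.
move=> x.
have -> : [set x] = @circle_repr R @^-1` [set circle_repr x].
  by apply/seteqP; split => y /= [] => [->//|/val_inj].
rewrite uniform_circle_repr//.
have /null_content_dominatesP := @dominates_uniform_prob R 0 1 ltr01.
by apply; [exact: measurable_set1|exact: lebesgue_measure_set1].
Qed.

(** The arc has measure [b - a > 0], so no null set contains it. This extracts actual points from an
    almost everywhere statement. *)
Lemma ae_exists_between (Q : circle R -> Prop) (a b : R) : 0 <= a -> a < b -> b <= 1 ->
  {ae lambda, forall x, Q x} -> exists2 x, a < circle_repr x <= b & Q x.
Proof.
move=> a0 ab b1 [A [mA A0 QA]]; apply: contrapT => nex.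
have mray c : measurable (@circle_repr R @^-1` `]c, +oo[%classic).
  by rewrite -[X in measurable X]setTI; exact: measurable_circle_repr.
have : (lambda (@circle_repr R @^-1` `]a, +oo[%classic) <=
    lambda ((@circle_repr R @^-1` `]b, +oo[%classic) `|` A))%E.
  apply: le_measure; rewrite ?inE//; first exact: measurableU.
  move=> x /=; rewrite !in_itv/= !andbT => ax.
  have [xb|bx] := leP (circle_repr x) b; last by left.
  by right; apply: QA => /= Qx; apply: nex; exists x => //; rewrite ax.
move=> H; have : (lambda (@circle_repr R @^-1` `]a, +oo[%classic) <=
    lambda (@circle_repr R @^-1` `]b, +oo[%classic) + lambda A)%E.
  by apply: (le_trans H); exact: (measureU2 _ (mray b) mA).
have rayE c : lambda (@circle_repr R @^-1` `]c, +oo[%classic) = (1 - clamp c)%:E.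
  by rewrite uniform_circle_repr//; exact: unif_ray.
rewrite [X in (_ <= _ + X)%E]A0 adde0 !rayE lee_fin.
by rewrite !clamp_id; lra.
Qed.

Lemma sqr_integral_bounded (f : circle R -> R) (M : R) : measurable_fun setT f ->
  (forall x, `|f x| <= M) -> (\int[lambda]_x ((f x) ^+ 2)%:E < +oo)%E.
Proof.
move=> mf fM; apply: (@le_lt_trans _ _ (\int[lambda]_x (M ^+ 2)%:E)%E).
  apply: ge0_le_integral => //.
  - by move=> x _; rewrite lee_fin sqr_ge0.
  - by apply/measurable_EFinP; exact: measurable_funX.
  - move=> x _; rewrite lee_fin -[leLHS]ger0_norm ?sqr_ge0// normrX ler_pXn2r ?nnegrE//.
    exact: le_trans (fM x).
by rewrite integral_cst// [X in (_ * X)%E]probability_setT mule1 ltry.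
Qed.

Lemma sinDn2pi (n : nat) (x : R) : sin (x + twopi * n%:R) = sin x.
Proof.
elim: n => [|n IH]; first by rewrite mulr0 addr0.
by rewrite -natr1 mulrDr mulr1 addrA sinD2pi.
Qed.

(** The phase [c] covers sines and cosines together. *)
Lemma sine_in_L20 (n : nat) (c : R) : (0 < n)%N ->
  exists v : L20 lambda, {ae lambda, forall x, v x = sin (twopi * n%:R * circle_repr x + c)}.
Proof.
move=> n0; pose w := twopi * n%:R.
have w0 : w != 0 by rewrite mulf_neq0 ?pnatr_eq0 -?lt0n// gt_eqF// pmulrn_lgt0// pi_gt0.
pose f (x : circle R) := sin (w * circle_repr x + c).
have mf : measurable_fun setT f.
  apply: (measurableT_comp (f := @sin R)).
    by apply: continuous_measurable_fun; exact: continuous_sin.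
  apply: measurable_funD => //; apply: measurable_funM => //; exact: measurable_circle_repr.
have [|v vE] := @L2_of_sqr_integrable _ _ _ lambda f mf.
  by apply: (sqr_integral_bounded mf (M := 1)) => x; exact: sin_max.
have vP : v \in @L20_pred R lambda.
  rewrite inE; apply: subset_closure.
  (* A quarter turn back is a primitive of the sine; it is periodic since [w] is a multiple of
     [2 pi]. *)
  pose h x := w^-1 * sin (w * x + (c - pi / 2)) + 0.
  have ss := @smooth_sin R w (c - pi / 2).
  have [sh hE] := smooth_lin w^-1 ss (@smooth_cst R 0).
  have h1 x : h (x + 1) = h x.
    by rewrite /h; congr (_ * _ + _); rewrite mulrDr mulr1 addrAC sinDn2pi.
  have [sm dE] := circle_smooth_repr sh h1.
  exists (h \o @circle_repr R); split => //.
  apply: filterS vE => x ->; rewrite dE /= -derive1n1 hE [derive1n 1 (fun=> 0)]derive1n1 derive1_cst addr0.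
  rewrite derive1n1 derive1E.
  have -> : 'D_1 (fun x : R => sin (w * x + (c - pi / 2))) (circle_repr x) =
    w * cos (w * circle_repr x + (c - pi / 2)).
    have := @is_derive1_comp _ (@sin R) (fun x => w * x + (c - pi / 2)) (circle_repr x) _ _
      (is_derive_sin _) (is_derive_affine _ _ _).
    by move/@derive_val => ->; rewrite mulrC.
  by rewrite mulKf// addrA cosBpihalf.
by exists (MkL20 vP).
Qed.

(* Multiplied by [2 sin (b / 2)], the sum telescopes. *)
Lemma sine_sum_eq0 (d : nat) (b y : R) : sin (b / 2) != 0 ->
  (exists n : nat, d%:R * b = twopi * n%:R) -> \sum_(k < d) sin (y + k%:R * b) = 0.
Proof.
move=> sb [n dn].
pose G (k : nat) := cos (y + k%:R * b - b / 2).
apply: (mulfI (mulf_neq0 (oner_neq0 R) sb)).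
apply: (@mulfI _ (- 2)); first by rewrite oppr_eq0 pnatr_eq0.
rewrite mul1r !mulr0 mulr_sumr mulr_sumr.
transitivity (\sum_(k < d) (G k.+1 - G k)).
  apply: eq_bigr => k _; rewrite /G.
  have -> : y + k.+1%:R * b - b / 2 = (y + k%:R * b) + b / 2.
    by rewrite -natr1; move: (k%:R) => m; field.
  by rewrite cosD cosB; ring.
rewrite -(big_mkord xpredT (fun k => G k.+1 - G k)) telescope_sumr// /G mul0r addr0 dn.
apply/eqP; rewrite subr_eq0 -!sinDpihalf; apply/eqP.
by rewrite -[RHS](sinDn2pi n); congr sin; ring.
Qed.

Lemma sin_natpi (i : nat) (x : R) : `|sin (x + i%:R * pi)| = `|sin x|.
Proof.
elim: i => [|i IH]; first by rewrite mul0r addr0.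
by rewrite -natr1 mulrDl mul1r addrA sinDpi normrN.
Qed.

End Trigonometric.

(** * A free family in the kernel of the transfer operator *)

Section Frequencies.
Context {R : realType} (d : nat) (d_gt1 : (1 < d)%N).
Local Notation lambda := (uniform_circle R).
Local Notation twopi := (pi *+ 2 : R).
Let d_gt0 : (0 < d)%N. Proof. exact: ltnW. Qed.
Let dR0 : d%:R != 0 :> R. Proof. by rewrite pnatr_eq0 -lt0n. Qed.

(** From one branch to the next the phase advances by [b]. Since [b / 2 = pi / d + i pi] and
    [0 < pi / d < pi] for [d >= 2], [sin (b / 2)] does not vanish, and the sum runs over whole
    turns. *)
Lemma transfer_sine (i : nat) (c : R) x :
  transfer d 1 (fun x => sin (twopi * (d * i).+1%:R * circle_repr x + c)) x = 0.
Proof.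
rewrite /transfer mul1r; pose b : R := twopi * (d * i).+1%:R / d%:R.
rewrite (eq_bigr (fun k : 'I_d => sin ((b * circle_repr x + c) + k%:R * b))); last first.
  move=> k _; rewrite circle_repr_branch//; congr sin.
  by rewrite /b; move: (k%:R) ((d * i).+1%:R) => m n; field.
apply: sine_sum_eq0; last by exists (d * i).+1; rewrite /b mulrC mulfVK.
rewrite -normr_eq0 (_ : b / 2 = pi / d%:R + i%:R * pi).
  rewrite sin_natpi normr_eq0 gt_eqF// sin_gt0_pi// divr_gt0 ?pi_gt0 ?ltr0n//=.
  by rewrite ltr_pdivrMr ?ltr0n// ltr_pMr ?pi_gt0// ltr1n.
by rewrite /b -natr1 natrM mulr2n; move: pi (i%:R) => p m; field.
Qed.

Lemma cisX (t : R) (n : nat) :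
  Complex (cos t) (sin t) ^+ n = Complex (cos (n%:R * t)) (sin (n%:R * t)).
Proof.
elim: n => [|n IH]; first by rewrite mul0r cos0 sin0.
rewrite exprSr IH -natr1 mulrDl mul1r cosD sinD.
by apply/eqP; rewrite eq_complex/=; apply/andP; split; apply/eqP; ring.
Qed.

Lemma fst_complexification_sum (V : normedModType R) (n : nat) (f : 'I_n -> complexification V) :
  (\sum_i f i).1 = \sum_i (f i).1.
Proof. by apply: (big_ind2 (fun (a : complexification V) b => a.1 = b)) => // a ? a' ? <- <-. Qed.

Lemma snd_complexification_sum (V : normedModType R) (n : nat) (f : 'I_n -> complexification V) :
  (\sum_i f i).2 = \sum_i (f i).2.
Proof. by apply: (big_ind2 (fun (a : complexification V) b => a.2 = b)) => // a ? a' ? <- <-. Qed.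

Lemma L20_sum_eq0 (n : nat) (u : 'I_n -> L20 lambda) (f : 'I_n -> circle R -> R) :
  (forall i, {ae lambda, forall x, u i x = f i x}) -> \sum_i u i = 0 ->
  {ae lambda, forall x, \sum_i f i x = 0}.
Proof.
move=> uf u0.
have := L2_sumE (index_enum 'I_n) (fun i => L20_val (u i)).
have -> : \sum_i L20_val (u i) = L20_val (\sum_i u i).
  by apply/esym; apply: (big_ind2 (fun a b => L20_val a = b)) => // a ? a' ? <- <-.
rewrite u0.
have := L2_scaleE 0 (0 : L2 lambda); rewrite scale0r.
have : {ae lambda, forall x, forall i, u i x = f i x} by exact: filter_forall.
apply: filterS3 => x H E0 E1.
by rewrite -(eq_bigr _ (fun i _ => H i)) -E1 E0 mul0r.
Qed.

(** The combination is a polynomial in [exp (2 i pi x)] that vanishes for almost every [x], hence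
    has more roots than its degree allows; its coefficients are the [c i], at the distinct exponents
    [d i + 1]. *)
Lemma cis_independent (n : nat) (c : 'I_n -> R[i]) :
  {ae lambda, forall x, \sum_i c i * Complex (cos (twopi * circle_repr x)) (sin (twopi * circle_repr x)) ^+ (d * i).+1 = 0} ->
  forall i, c i = 0.
Proof.
move=> H; pose e x := Complex (cos (twopi * circle_repr x)) (sin (twopi * circle_repr x)) : R[i].
pose p : {poly R[i]} := \sum_i c i *: 'X^((d * i).+1).
have pe : {ae lambda, forall x, root p (e x)}.
  apply: filterS H => x Hx; rewrite rootE horner_sum; apply/eqP; rewrite -[RHS]Hx.
  by apply: eq_bigr => i _; rewrite hornerZ hornerXn.
have p0 : p = 0.
  apply/eqP; apply: contraT => pn0.
  (* One root is picked in each of [N] consecutive arcs of the half circle [[0, 1/2]], on which the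
     cosine alone separates points. *)
  pose N := (size p).+1; have N0 : 0 < N%:R :> R by rewrite ltr0n.
  have /choice[x xP] (j : nat) : exists y : circle R, (j < N)%N ->
      (j%:R / (2 * N%:R) < circle_repr y <= j.+1%:R / (2 * N%:R)) /\ root p (e y).
    have [jN|jN] := boolP (j < N)%N; last by exists point.
    have [|||x xj rx] := @ae_exists_between R _ (j%:R / (2 * N%:R)) (j.+1%:R / (2 * N%:R)) _ _ _ pe.
    - by rewrite divr_ge0// mulr_ge0.
    - by rewrite ltr_pM2r ?invr_gt0 ?mulr_gt0// ltr_nat.
    - rewrite ler_pdivrMr ?mulr_gt0// mul1r.
      by apply: (@le_trans _ _ N%:R); rewrite ?ler_nat// ler_peMl// ler1n.
    by exists x.
  have xlt j k : (j < k)%N -> (k < N)%N -> circle_repr (x j) < circle_repr (x k).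
    move=> jk kN; have [/andP[_ xj] _] := xP j (ltn_trans jk kN).
    have [/andP[xk _] _] := xP k kN.
    apply: (le_lt_trans xj); apply: le_lt_trans xk.
    by rewrite ler_pM2r ?invr_gt0 ?mulr_gt0// ler_nat.
  have twopi_gt0 : 0 < twopi by rewrite pmulrn_lgt0// pi_gt0.
  have xinj : {in iota 0 N &, injective (fun j => e (x j))}.
    have half j : (j < N)%N -> twopi * circle_repr (x j) \in `[0, pi].
      move=> jN; have [/andP[x1 x2] _] := xP j jN.
      have := circle_reprP (x j) => /andP[x0 _].
      rewrite in_itv/= mulr_ge0 ?(ltW twopi_gt0)//=.
      have : circle_repr (x j) <= 1 / 2.
        apply: (le_trans x2); rewrite ler_pdivrMr ?mulr_gt0//.
        by rewrite mulrA div1r mulVf ?mul1r ?ler_nat// pnatr_eq0.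
      move=> h; rewrite mulrnAl -mulrnAr -[leRHS]mulr1 ler_wpM2l ?pi_ge0//.
      by rewrite -mulr_natr; lra.
    move=> j k; rewrite !mem_iota !add0n /= => jN kN [ce _].
    have := cos_inj (half j jN) (half k kN) ce.
    move/mulfI => /(_ _)E; have {}E : circle_repr (x j) = circle_repr (x k).
      by apply: E; rewrite gt_eqF.
    case: (ltngtP j k) => // [jk|kj].
      by have := xlt _ _ jk kN; rewrite E ltxx.
    by have := xlt _ _ kj jN; rewrite E ltxx.
  have rr : all (root p) [seq e (x j) | j <- iota 0 N].
    by apply/allP => _ /mapP[j + ->]; rewrite mem_iota add0n => jN; exact: (xP j jN).2.
  have := max_poly_roots pn0 rr; rewrite map_inj_in_uniq// iota_uniq => /(_ isT).
  by rewrite size_map size_iota ltnNge leqnSn.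
move=> i; have := congr1 (fun q : {poly R[i]} => q`_(d * i).+1) p0.
rewrite coef0 coef_sum (bigD1 i)//= coefZ coefXn eqxx mulr1 big1 ?addr0// => j ji.
rewrite coefZ coefXn eqSS eqn_mul2l gtn_eqF//= (_ : (_ == _) = false) ?mulr0//.
by apply/negbTE; rewrite eq_sym; apply: contra ji => /eqP/val_inj ->.
Qed.

(** The family is [exp (2 i pi (d j + 1) x)]: the cosine [k j] is its real part, the sine [s j] its
    imaginary part. *)
Lemma transfer_kernel_family (P : {linear L20 lambda -> L20 lambda}) :
  (forall v, {ae lambda, forall x, P v x = transfer d d%:R^-1 v x}) ->
  exists v : nat -> complexification (L20 lambda),
    (forall i, complexify P (v i) = 0) /\
    (forall n (c : 'I_n -> R[i]), \sum_i c i *: v i = 0 -> forall i, c i = 0).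
Proof.
move=> PE.
have [s sE] := choice (fun i : nat => @sine_in_L20 R (d * i).+1 0 (ltn0Sn _)).
have [k kE] := choice (fun i : nat => @sine_in_L20 R (d * i).+1 (pi / 2) (ltn0Sn _)).
exists (fun i => (k i, s i)); split=> [i|n c].
  by congr pair; [apply: (transfer_kernel d_gt0 PE (kE i))|apply: (transfer_kernel d_gt0 PE (sE i))];
    exact: transfer_sine.
move=> cv; apply: cis_independent.
have /(congr1 fst) := cv; have /(congr1 snd) := cv.
rewrite fst_complexification_sum snd_complexification_sum /= => c2 c1.
pose cs i (x : circle R) := cos (twopi * (d * i).+1%:R * circle_repr x).
pose sn i (x : circle R) := sin (twopi * (d * i).+1%:R * circle_repr x).
have {}kE i : {ae lambda, forall x, k i x = cs i x}.
  by apply: filterS (kE i) => x ->; rewrite sinDpihalf.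
have {}sE i : {ae lambda, forall x, s i x = sn i x}.
  by apply: filterS (sE i) => x ->; rewrite addr0.
have scale_ae (a : R) (w : L20 lambda) f : {ae lambda, forall x, w x = f x} ->
    {ae lambda, forall x, (a *: w) x = a * f x}.
  by move=> wf; move: (L2_scaleE a (L20_val w)) wf; apply: filterS2 => x H E; rewrite -E -H.
have f1 (i : 'I_n) : {ae lambda, forall x, (complex.Re (c i) *: k i - complex.Im (c i) *: s i) x =
    complex.Re (c i) * cs i x - complex.Im (c i) * sn i x}.
  move: (L2_subE (L20_val (complex.Re (c i) *: k i)) (L20_val (complex.Im (c i) *: s i))).
  move: (scale_ae (complex.Re (c i)) _ _ (kE i)) (scale_ae (complex.Im (c i)) _ _ (sE i)).
  by apply: filterS3 => x <- <- <-.
have f2 (i : 'I_n) : {ae lambda, forall x, (complex.Re (c i) *: s i + complex.Im (c i) *: k i) x =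
    complex.Re (c i) * sn i x + complex.Im (c i) * cs i x}.
  move: (L2_addE (L20_val (complex.Re (c i) *: s i)) (L20_val (complex.Im (c i) *: k i))).
  move: (scale_ae (complex.Re (c i)) _ _ (sE i)) (scale_ae (complex.Im (c i)) _ _ (kE i)).
  by apply: filterS3 => x <- <- <-.
move: (L20_sum_eq0 f1 c1) (L20_sum_eq0 f2 c2); apply: filterS2 => x E1 E2.
transitivity (Complex (\sum_i (complex.Re (c i) * cs i x - complex.Im (c i) * sn i x))
   (\sum_i (complex.Re (c i) * sn i x + complex.Im (c i) * cs i x))); last by rewrite E1 E2.
apply: (big_ind3 (fun (a : R[i]) b b' => a = Complex b b')) => //.
  by move=> a b b' a' a1 a2 -> ->.
move=> i _; rewrite cisX /cs /sn (_ : (d * i).+1%:R * (twopi * circle_repr x) = twopi * (d * i).+1%:R * circle_repr x).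
  by case: (c i) => a b.
by rewrite mulrCA mulrA.
Qed.

End Frequencies.

(** * Transport cost of a pair of maps, and lifts to the line *)

Section Transport.
Context {R : realType}.
Local Notation lambda := (uniform_circle R).

Lemma measurable_circle_mdist :
  measurable_fun setT (fun z : circle R * circle R => ((mdist z.1 z.2) ^+ 2)%:E).
Proof.
apply/measurable_EFinP; apply: measurable_funX.
have m1 : measurable_fun setT (fun z : circle R * circle R => circle_repr z.1).
  exact: measurableT_comp (@measurable_circle_repr R) measurable_fst.
have m2 : measurable_fun setT (fun z : circle R * circle R => circle_repr z.2).
  exact: measurableT_comp (@measurable_circle_repr R) measurable_snd.
have m3 : measurable_fun setT (fun z : circle R * circle R => `|circle_repr z.1 - circle_repr z.2|).
  by apply: measurableT_comp => //; exact: measurable_funB.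
by apply: measurable_minr => //; exact: measurable_funB.
Qed.

(** The law of [(f, g)] under lambda is a coupling. The infimum lies between 0 and [B], hence is
    finite and [fine] does not alter it. *)
Lemma wasserstein_le (mu nu : probability (circle R) R) (f g : circle R -> circle R) (B : R) :
  measurable_fun setT f -> measurable_fun setT g ->
  (forall A, measurable A -> lambda (f @^-1` A) = mu A) ->
  (forall A, measurable A -> lambda (g @^-1` A) = nu A) ->
  (\int[lambda]_x ((mdist (f x) (g x)) ^+ 2)%:E <= B%:E)%E ->
  wasserstein mu nu <= Num.sqrt B.
Proof.
move=> mf mg fmu gnu fgB.
have mfg : measurable_fun setT (fun x => (f x, g x)) by exact: measurable_fun_pair.
pose theta : {mfun circle R >-> (circle R * circle R)%type} := mfun_Sub (mem_set mfg).
pose Q : probability (circle R * circle R)%type R := distribution lambda theta.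
rewrite /wasserstein ler_wsqrtr//.
set I := ereal_inf _.
have I0 : (0 <= I)%E.
  apply: le_ereal_inf_tmp => _ [Q' _ <-]; apply: integral_ge0 => z _.
  by rewrite lee_fin sqr_ge0.
have IB : (I <= B%:E)%E.
  apply: le_trans fgB; apply: ereal_inf_lbound; exists Q.
    by split => A mA; [rewrite -fmu|rewrite -gnu].
  rewrite (ge0_integral_pushforward mfg)//.
  - exact: measurable_circle_mdist.
  - by move=> z _; rewrite lee_fin sqr_ge0.
rewrite -lee_fin fineK// ge0_fin_numE//.
by apply: (le_lt_trans IB); exact: ltry.
Qed.

Lemma expanding_proj d (w : R) : expanding d (circle_proj w) = circle_proj (d%:R * w).
Proof.
have [m wm] := circle_proj_repr w; rewrite [in RHS]wm mulrDr.
by rewrite -[d%:R * m%:~R](_ : (d%:Z * m)%:~R = _) ?circle_proj_addz// intrM.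
Qed.

Lemma displace_proj (w : {mfun circle R >-> R}) (y : R) :
  displace w (circle_proj y) = circle_proj (y + w (circle_proj y)).
Proof.
have [m ym] := circle_proj_repr y.
rewrite /displace -[RHS](circle_proj_addz _ (- m)) mulrNz; congr circle_proj.
by move: (w _) => a; lra.
Qed.

Lemma branch_surj d (x : circle R) : (0 < d)%N -> exists k : 'I_d, x = branch d k (expanding d x).
Proof.
move=> d0; have dR : 0 < d%:R :> R by rewrite ltr0n.
have /andP[x0 x1] := circle_reprP x.
have /andP[f0 f1] := floor_itv (d%:R * circle_repr x).
case E : (Num.floor (d%:R * circle_repr x)) => [k|k]; last first.
  have : 0 <= d%:R * circle_repr x by rewrite mulr_ge0// ltW.
  by rewrite -floor_ge0 E.
have kd : (k < d)%N.
  rewrite -(ltr_nat R); apply: (le_lt_trans (y := d%:R * circle_repr x)).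
    by move: f0; rewrite E.
  by rewrite gtr_pMr.
exists (Ordinal kd); apply: val_inj; rewrite [RHS](circle_repr_branch _ kd) /=.
by rewrite E -pmulrn subrK mulrC mulKf// gt_eqF.
Qed.

Lemma ae_preserving (psi : circle R -> circle R) (Q : circle R -> Prop) :
  measurable_fun setT psi ->
  (forall A, measurable A -> lambda (psi @^-1` A) = lambda A) ->
  {ae lambda, forall x, Q x} -> {ae lambda, forall x, Q (psi x)}.
Proof.
move=> mpsi psiE [A [mA A0 QA]]; exists (psi @^-1` A); split.
- by rewrite -[X in measurable X]setTI; exact: mpsi.
- by rewrite -[RHS]A0 -[RHS]psiE.
- by move=> x /= nQ; exact: QA.
Qed.

Lemma uniform_circle_near_ends (r : R) : 0 <= r ->
  (lambda [set x | circle_repr x <= r \/ 1 - r < circle_repr x]%R <= (2 * r)%:E)%E.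
Proof.
move=> r0.
have -> : [set x : circle R | circle_repr x <= r \/ 1 - r < circle_repr x] =
    @circle_repr R @^-1` (`]-oo, r]%classic `|` `](1 - r), +oo[%classic).
  by apply/seteqP; split => x /=; rewrite !in_itv/= andbT.
rewrite uniform_circle_repr; last by apply: measurableU.
apply: (le_trans (measureU2 _ _ _)) => //.
rewrite [X in (X + _ <= _)%E]unif_rayc [X in (_ + X <= _)%E]unif_ray -EFinD lee_fin.
by case: clampP => *; case: clampP => *; lra.
Qed.

End Transport.

(** * The measure-preserving rearrangement of the circle *)

Section Rearrangement.
Context {R : realType}.
Variables (d N : nat) (tau : R) (g : R -> R).
Hypotheses (d_gt0 : (0 < d)%N) (N_gt0 : (0 < N)%N).
Local Notation lambda := (uniform_circle R).
Local Notation U := (uniform_prob (@ltr01 R) : probability (measurableTypeR R) R).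
Let d0 : 0 < d%:R :> R. Proof. by rewrite ltr0n. Qed.
Let N0 : 0 < N%:R :> R. Proof. by rewrite ltr0n. Qed.

(* The velocity on the branch [k], frozen on the [c]-th cell of length [1 / N]. *)
Definition cell_speed (c k : R) : R := d%:R * g ((c / N%:R + k) / d%:R).

(** The map of [unif_rearrangement] for the shifts [tau * cell_speed c j]. The indices are real
    because [rearrange] reads them off a point, the cell as [N y - u] and the branch as [d x - y],
    by measurable formulas. *)
Definition cell_map (c k u : R) : R :=
  d%:R^-1 * \sum_(j < d) clamp (u + tau * cell_speed c k - tau * cell_speed c j%:R).

(* Frozen cell by cell, the flow followed by [expanding d] sends [U], on a
   uniformly chosen branch, to a mixture of [d] translates of [U]; [cell_map]
   transports that mixture monotonically back to [U]. The cells are handled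
   independently, so no continuity across their ends is needed. *)
Definition rearrange (x : circle R) : circle R :=
  let y := circle_repr (expanding d x) in
  let u := circle_repr (expanding N (expanding d x)) in
  circle_proj ((cell_map (N%:R * y - u) (d%:R * circle_repr x - y) u + (N%:R * y - u)) / N%:R).

Lemma rearrange_branch k c z : (k < d)%N -> (c < N)%N ->
  rearrange (branch d k (branch N c z)) =
  circle_proj ((cell_map c%:R k%:R (circle_repr z) + c%:R) / N%:R).
Proof.
move=> kd cN; rewrite /rearrange expanding_branch// expanding_branch//.
have -> : N%:R * circle_repr (branch N c z) - circle_repr z = c%:R.
  by rewrite circle_repr_branch// mulrC mulfVK ?gt_eqF//; lra.
have -> // : d%:R * circle_repr (branch d k (branch N c z)) - circle_repr (branch N c z) = k%:R.
by rewrite (circle_repr_branch _ kd) mulrC mulfVK ?gt_eqF//; lra.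
Qed.

Lemma measurable_cell_map d' (T : measurableType d') (c k u : T -> R) : continuous g ->
  measurable_fun setT c -> measurable_fun setT k -> measurable_fun setT u ->
  measurable_fun setT (fun x => cell_map (c x) (k x) (u x)).
Proof.
move=> cg mc mk mu.
have mg : measurable_fun setT g by exact: continuous_measurable_fun.
have mspeed (k' : T -> R) : measurable_fun setT k' ->
    measurable_fun setT (fun x => tau * cell_speed (c x) (k' x)).
  move=> mk'; apply: measurable_funM => //; apply: measurable_funM => //.
  apply: (measurableT_comp mg); apply: measurable_funM => //.
  by apply: measurable_funD => //; exact: measurable_funM.
apply: measurable_funM => //; apply: measurable_sum => j.
apply: (measurableT_comp measurable_clamp); apply: measurable_funB; last exact: mspeed.
by apply: measurable_funD => //; exact: mspeed.
Qed.

Lemma measurable_rearrange : continuous g -> measurable_fun setT rearrange.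
Proof.
move=> cg; have mr := @measurable_circle_repr R.
have mE : measurable_fun setT (fun x : circle R => circle_repr (expanding d x)).
  exact: measurableT_comp mr (@measurable_expanding R d).
have mEE : measurable_fun setT (fun x : circle R => circle_repr (expanding N (expanding d x))).
  exact: measurableT_comp mr (measurableT_comp (@measurable_expanding R N) (@measurable_expanding R d)).
have mc : measurable_fun setT (fun x : circle R =>
    N%:R * circle_repr (expanding d x) - circle_repr (expanding N (expanding d x))).
  by apply: measurable_funB => //; exact: measurable_funM.
apply: (measurableT_comp (@measurable_circle_proj R)).
apply: measurable_funM => //; apply: measurable_funD => //.
apply: measurable_cell_map => //; apply: measurable_funB => //; exact: measurable_funM.
Qed.

(** Lambda is split over the branches and the cells. Within one cell, the sum over the branches is
    [unif_rearrangement]; the sum over the cells then gives back [lambda A]. *)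
Lemma rearrange_preserving A : continuous g -> measurable A ->
  lambda (rearrange @^-1` A) = lambda A.
Proof.
move=> cg mA; set B := rearrange @^-1` A.
have mB : measurable B.
  by rewrite -[B]setTI; exact: measurable_rearrange.
have mpre (f : circle R -> circle R) C : measurable_fun setT f -> measurable C -> measurable (f @^-1` C).
  by move=> mf mC; rewrite -[X in measurable X]setTI; exact: mf.
have cell k c : (k < d)%N -> (c < N)%N -> lambda (branch N c @^-1` (branch d k @^-1` B)) =
    U ((fun u : R => cell_map c%:R k%:R u) @^-1`
      ((fun w : R => circle_proj ((w + c%:R) / N%:R)) @^-1` A)).
  move=> kd cN; rewrite -uniform_circle_repr.
    by congr (lambda _); apply/seteqP; split => z; rewrite /B /preimage/= rearrange_branch.
  rewrite -[X in measurable X]setTI.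
  apply: (_ : measurable_fun setT (fun u : measurableTypeR R => circle_proj ((cell_map c%:R k%:R u + c%:R) / N%:R))) => //.
  apply: (measurableT_comp (@measurable_circle_proj R)).
  apply: measurable_funM => //; apply: measurable_funD => //.
  exact: measurable_cell_map.
have fB : lambda B \is a fin_num by rewrite fin_num_measure.
have fA : lambda A \is a fin_num by rewrite fin_num_measure.
have : (N%:R%:E * (d%:R%:E * lambda B) = d%:R%:E * (N%:R%:E * lambda A))%E.
  rewrite -(uniform_circle_branches d_gt0 mB) ge0_sume_distrr//.
  rewrite (eq_bigr (fun k : 'I_d => \sum_(c < N) U ((fun u : R => cell_map c%:R k%:R u) @^-1`
      ((fun w : R => circle_proj ((w + c%:R) / N%:R)%R) @^-1` A)))%E); last first.
    move=> k _; rewrite -(uniform_circle_branches N_gt0); last exact: mpre (measurable_branch d k) mB.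
    by apply: eq_bigr => c _; rewrite cell.
  rewrite exchange_big/= -(unif_real_branches N_gt0 mA) ge0_sume_distrr//.
  apply: eq_bigr => c _.
  rewrite -(unif_rearrangement (fun j : 'I_d => tau * cell_speed c%:R j%:R) d_gt0)//.
  rewrite -[X in measurable X]setTI.
  apply: (_ : measurable_fun setT (fun u : measurableTypeR R => circle_proj ((u + c%:R) / N%:R))) => //.
  apply: (measurableT_comp (@measurable_circle_proj R)).
  by apply: measurable_funM => //; exact: measurable_funD.
rewrite -(fineK fB) -(fineK fA) -!EFinM => -[] /eqP.
by rewrite mulrCA (inj_eq (mulfI (lt0r_neq0 d0))) (inj_eq (mulfI (lt0r_neq0 N0))) => /eqP ->.
Qed.

End Rearrangement.

(** * Pointwise error of the rearrangement *)

Section Estimate.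
Context {R : realType}.
Variables (d N : nat) (t S eta : R) (g : R -> R).
Hypotheses (d_gt0 : (0 < d)%N) (N_gt0 : (0 < N)%N).
Hypotheses (g_periodic : forall x, g (x + 1) = g x) (g_le : forall x, `|g x| <= S).
Hypothesis g_osc : forall x y, `|x - y| <= N%:R^-1 -> `|g x - g y| <= eta.
Local Notation lambda := (uniform_circle R).
Let d0 : 0 < d%:R :> R. Proof. by rewrite ltr0n. Qed.
Let N0 : 0 < N%:R :> R. Proof. by rewrite ltr0n. Qed.
Let S0 : 0 <= S. Proof. exact: le_trans (g_le 0). Qed.
Local Notation tau := (t * N%:R).
Local Notation speed := (cell_speed d N g).
Local Notation psi := (rearrange d N tau g).

(** A bound for [tau] times the gap between two cell speeds, each at most [d S] in absolute value.
    Here [tau = t N], because a cell of length [1 / N] is rescaled to length 1. *)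
Definition margin : R := 2 * `|tau| * (d%:R * S).

Definition near_end (x : circle R) : bool :=
  let u := circle_repr (expanding N (expanding d x)) in (u <= margin) || (1 - margin < u).

Lemma cell_speed_le c k : `|speed c k| <= d%:R * S.
Proof. by rewrite /cell_speed normrM ger0_norm ?ler_pM2l// ltW. Qed.

Lemma mean_norm_le (f : 'I_d -> R) (M : R) : (forall j, `|f j| <= M) ->
  `|d%:R^-1 * \sum_j f j| <= M.
Proof.
move=> fM; rewrite normrM ger0_norm ?invr_ge0 ?(ltW d0)// ler_pdivrMl//.
apply: (le_trans (ler_norm_sum _ _ _)); apply: (le_trans (ler_sum _ (fun j _ => fM j))).
by rewrite sumr_const card_ord mulr_natl.
Qed.

Lemma cell_map_itv c k u : 0 <= cell_map d N tau g c k u <= 1.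
Proof.
rewrite mulr_ge0 ?invr_ge0 ?(ltW d0)//=; last first.
  by apply: sumr_ge0 => j _; have /andP[] := clamp_itv (u + tau * speed c k - tau * speed c j%:R).
apply: (le_trans (ler_norm _)); apply: mean_norm_le => j.
by have /andP[h0 h1] := clamp_itv (u + tau * speed c k - tau * speed c j%:R); rewrite ger0_norm.
Qed.

(** All arguments of [clamp] lie within [margin] of [u]. Away from the ends they stay in [[0, 1]],
    so [cell_map] is an exact translation; near the ends [clamp], being 1-Lipschitz and fixing [u],
    errs by at most [2 * margin]. *)
Lemma cell_map_error c k u : 0 <= u <= 1 ->
  `|u + tau * (speed c k - d%:R^-1 * \sum_(j < d) speed c j%:R) - cell_map d N tau g c k u| <=
  if (u <= margin) || (1 - margin < u) then 2 * margin else 0.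
Proof.
move=> u01; pose z (j : 'I_d) := u + tau * speed c k - tau * speed c j%:R.
have zu j : `|z j - u| <= margin.
  rewrite (_ : z j - u = tau * (speed c k - speed c j%:R)); last by rewrite /z; ring.
  rewrite normrM /margin; have := ler_normB (speed c k) (speed c j%:R).
  have := cell_speed_le c k; have := cell_speed_le c j%:R; have := normr_ge0 tau.
  move: `|tau| `|speed c k - _| `|speed c k| `|speed c _| => a b b1 b2 a0 h1 h2 h3.
  have : a * b <= a * (2 * (d%:R * S)) by rewrite ler_wpM2l//; lra.
  lra.
have -> : u + tau * (speed c k - d%:R^-1 * \sum_(j < d) speed c j%:R) - cell_map d N tau g c k u =
    d%:R^-1 * \sum_j (z j - clamp (z j)).
  rewrite sumrB [RHS]mulrBr /cell_map; congr (_ - _).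
  set b := \sum_(j < d) speed c j%:R.
  have -> : \sum_j z j = d%:R * (u + tau * speed c k) - tau * b.
    by rewrite /z sumrB sumr_const card_ord mulr_natl /b mulr_sumr.
  by move: b (speed c k) => b a; field; rewrite gt_eqF.
apply: mean_norm_le => j; have := zu j; case: ifPn => [_|].
  move=> zuj; rewrite (_ : z j - clamp (z j) = (z j - u) - (clamp (z j) - clamp u)); last first.
    by rewrite [clamp u]clamp_id//; ring.
  apply: (le_trans (ler_normB _ _)); rewrite mulr2n mulrDl mul1r; apply: lerD => //.
  exact: le_trans (clamp_lip _ _) zuj.
rewrite negb_or -ltNge -leNgt ler_norml => /andP[um um1] /andP[h1 h2].
by rewrite clamp_id ?subrr ?normr0//; lra.
Qed.

(** [V] and [W] stand for the values of [v] at [x] and of [L v] at [psi x], which are close to those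
    of [g] only in mean square; [k] is an integer lost on the circle. The three errors come from the
    ends of the cells ([2 * margin / N]), from freezing the speed at [x], and from freezing the mean
    speed at [psi x]. *)
Lemma rearrange_estimate x V W : exists Y : R, exists k : nat, psi x = circle_proj Y /\
  `|d%:R * (circle_repr x + t * V) - k%:R - (Y + t * W)| <=
    (if near_end x then 4 * `|t| * (d%:R * S) else 0) +
    `|t| * (d%:R * `|V - g (circle_repr x)| + d%:R * eta) +
    `|t| * (`|W - \sum_(j < d) g (circle_repr (branch d j (psi x)))| + d%:R * eta).
Proof.
have [k xE] := branch_surj x d_gt0; have [c yE] := branch_surj (expanding d x) N_gt0.
pose z := expanding N (expanding d x); rewrite -/z in yE; rewrite yE in xE.
pose u := circle_repr z; have /andP[u0 u1] := circle_reprP z.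
pose G := cell_map d N tau g c%:R k%:R u.
pose Y := (G + c%:R) / N%:R.
have psiE : psi x = circle_proj Y by rewrite {1}xE rearrange_branch.
exists Y, k; split => //.
have reprx : circle_repr x = ((u + c%:R) / N%:R + k%:R) / d%:R.
  by rewrite {1}xE (circle_repr_branch _ (ltn_ord k)) (circle_repr_branch _ (ltn_ord c)).
pose a := speed c%:R k%:R; pose abar := d%:R^-1 * \sum_(j < d) speed c%:R j%:R.
have osc (p q k' : R) : `|p - q| <= 1 -> `|g ((p / N%:R + k') / d%:R) - g ((q / N%:R + k') / d%:R)| <= eta.
  move=> pq; apply: g_osc.
  rewrite -mulrBl opprD addrACA subrr addr0 -mulrBl !normrM !normfV (ger0_norm (ltW d0)) (ger0_norm (ltW N0)).
  rewrite ler_pdivrMr// ler_pdivrMr// mulrAC mulVf ?gt_eqF// mul1r.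
  by apply: (le_trans pq); rewrite ler1n.
have E2 : `|d%:R * V - a| <= d%:R * `|V - g (circle_repr x)| + d%:R * eta.
  rewrite -mulrDr -[leLHS](_ : d%:R * `|V - a / d%:R| = _); last first.
    by rewrite -[X in X * _](ger0_norm (ltW d0)) -normrM mulrBr mulrCA mulfV ?gt_eqF// mulr1.
  rewrite ler_pM2l// -(subrKA (g (circle_repr x))); apply: (le_trans (ler_normD _ _)); rewrite lerD2l.
  rewrite /a /cell_speed mulrC mulKf ?gt_eqF// reprx.
  by apply: osc; rewrite addrK ger0_norm// ltW.
have abarE : abar = \sum_(j < d) g ((c%:R / N%:R + j%:R) / d%:R).
  by rewrite /abar /cell_speed -mulr_sumr mulKf// gt_eqF.
have E3 : `|W - abar| <= `|W - \sum_(j < d) g (circle_repr (branch d j (psi x)))| + d%:R * eta.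
  rewrite -(subrKA (\sum_(j < d) g (circle_repr (branch d j (psi x))))).
  apply: (le_trans (ler_normD _ _)); rewrite lerD2l psiE.
  have -> : \sum_(j < d) g (circle_repr (branch d j (circle_proj Y))) = \sum_(j < d) g ((Y + j%:R) / d%:R).
    have [m Ym] := circle_proj_repr Y.
    rewrite [in RHS]Ym (periodic_addz (h := fun y => \sum_(j < d) g ((y + j%:R) / d%:R))); last first.
      exact: branch_sum_periodic.
    by apply: eq_bigr => j _; rewrite circle_repr_branch.
  rewrite abarE -sumrB; apply: (le_trans (ler_norm_sum _ _ _)).
  apply: (@le_trans _ _ (\sum_(j < d) eta)); last by rewrite sumr_const card_ord mulr_natl.
  (* [cell_map] takes its values in [[0, 1]], so [Y] stays in the closed cell [c] and the
     oscillation bound applies. *)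
  apply: ler_sum => j _; apply: osc; rewrite addrK.
  by have /andP[G0 G1] := cell_map_itv c%:R k%:R u; rewrite ger0_norm.
have E1 : `|(u + tau * (a - abar) - G) / N%:R| <= if near_end x then 4 * `|t| * (d%:R * S) else 0.
  rewrite normrM normfV (ger0_norm (ltW N0)) ler_pdivrMr//.
  apply: (le_trans (cell_map_error _ _ _)); first by rewrite u0 ltW.
  rewrite /near_end -/z -/u; case: ifP => _; last by rewrite mul0r.
  rewrite /margin normrM (ger0_norm (ltW N0)) le_eqVlt; apply/orP; left; apply/eqP; ring.
have -> : d%:R * (circle_repr x + t * V) - k%:R - (Y + t * W) =
    (u + tau * (a - abar) - G) / N%:R + t * (d%:R * V - a) - t * (W - abar).
  have alg (D M k' c' a' b' G' : R) : 0 < D -> 0 < M ->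
      D * (((u + c') / M + k') / D + t * V) - k' - ((G' + c') / M + t * W) =
      (u + t * M * (a' - b') - G') / M + t * (D * V - a') - t * (W - b').
    by move=> D0 M0; field; rewrite !gt_eqF.
  by rewrite reprx; exact: alg.
apply: (le_trans (ler_normB _ _)); rewrite [X in _ + X]normrM; apply: lerD; last by rewrite ler_wpM2l.
apply: (le_trans (ler_normD _ _)); rewrite [X in _ + X]normrM; apply: lerD => //; by rewrite ler_wpM2l.
Qed.

End Estimate.

(** * The Wasserstein estimate and the derivative *)

Section Gateaux.
Context {R : realType} (d : nat) (d_gt0 : (0 < d)%N).
Local Notation lambda := (uniform_circle R).
Variables (nu : probability (circle R) R) (L : {linear L20 lambda -> L20 nu}).
Hypothesis nuE : forall A, measurable A -> nu A = lambda A.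
Hypothesis LE : forall v, {ae nu, forall x, L v x = transfer d 1 v x}.
Let d0 : 0 < d%:R :> R. Proof. by rewrite ltr0n. Qed.

Lemma ae_nu (Q : circle R -> Prop) : {ae nu, forall x, Q x} -> {ae lambda, forall x, Q x}.
Proof. by move=> [A [mA A0 QA]]; exists A; split => //; rewrite -[LHS]nuE. Qed.

(** The set is pulled back, by two maps preserving lambda, from two arcs of length at most [margin]
    at the ends of the fundamental domain. *)
Lemma near_end_measure (N : nat) (t S : R) : (0 < N)%N -> 0 <= S ->
  measurable [set x : circle R | near_end d N t S x] /\
  (lambda [set x | near_end d N t S x] <= (2 * margin d N t S)%:E)%E.
Proof.
move=> N0 S0; pose r := margin d N t S.
have r0 : 0 <= r by rewrite !mulr_ge0.
pose B := @circle_repr R @^-1` (`]-oo, r]%classic `|` `](1 - r), +oo[%classic).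
have mB : measurable B.
  rewrite -[B]setTI; apply: (@measurable_circle_repr R) => //.
  exact: measurableU.
have -> : [set x : circle R | near_end d N t S x] =
    expanding d @^-1` (expanding N @^-1` B).
  apply/seteqP; split => x; rewrite /B /preimage/= !in_itv/= andbT /near_end -/r => /orP //.
have mNB : measurable (@expanding R N @^-1` B).
  by rewrite -[X in measurable X]setTI; exact: measurable_expanding.
split; first by rewrite -[X in measurable X]setTI; exact: measurable_expanding.
rewrite uniform_circle_expanding// uniform_circle_expanding//.
have -> : B = [set x : circle R | circle_repr x <= r \/ 1 - r < circle_repr x].
  by apply/seteqP; split => x; rewrite /B /= !in_itv/= andbT.
exact: uniform_circle_near_ends.
Qed.

(** [(A + B + C)^2] is at most 3 times the sum of the squares, and splitting [B] and [C] in two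
    doubles the factor to 6; their [eta] terms are merged. *)
Lemma sqr_sum3_le (D A p q eta c : R) : 0 <= D -> 0 <= c -> D <= A + c * (d%:R * p + d%:R * eta) + c * (q + d%:R * eta) ->
  D ^+ 2 <= 3 * A ^+ 2 + 6 * c ^+ 2 * d%:R ^+ 2 * p ^+ 2 + 6 * c ^+ 2 * q ^+ 2
    + 2 * (6 * c ^+ 2 * d%:R ^+ 2) * eta ^+ 2.
Proof.
move=> D0 c0 DA; set B := c * (d%:R * p + _) in DA; set C := c * (q + _) in DA.
have h1 : D ^+ 2 <= (A + B + C) ^+ 2 by rewrite ler_pXn2r// nnegrE// (le_trans D0 DA).
have h2 : 0 <= (A - B) ^+ 2 + (B - C) ^+ 2 + (A - C) ^+ 2 by rewrite !addr_ge0// sqr_ge0.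
have h3 : 0 <= (c * (d%:R * p - d%:R * eta)) ^+ 2 by rewrite sqr_ge0.
have h4 : 0 <= (c * (q - d%:R * eta)) ^+ 2 by rewrite sqr_ge0.
move: h1 h2 h3 h4; rewrite /B /C; move: (d%:R : R) => e; lra.
Qed.

(** The coupling is the pair [expanding d (x + t v x)] and [psi x + t (L v)(psi x)]. In the bound,
    192 is [3 * 4^2] from the squared end error times 4 from [2 * margin], and 24 is [6 + 6 + 12]
    from [p], [q] and [eta]. *)
Lemma wasserstein_transfer_le (g : R -> R) (N : nat) (t S eta : R) (v : L20 lambda) :
  (0 < N)%N -> continuous g ->
  (forall x, g (x + 1) = g x) -> (forall x, `|g x| <= S) ->
  (forall x y, `|x - y| <= N%:R^-1 -> `|g x - g y| <= eta) ->
  (\int[lambda]_x (((v : L2 lambda) x - g (circle_repr x)) ^+ 2)%:E <= (eta ^+ 2)%:E)%E ->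
  wasserstein (distribution (displacement (t *: v : L20 lambda)) (expanding d))
              (displacement (t *: L v : L20 nu)) <=
  Num.sqrt (192 * `|t| ^+ 3 * N%:R * (d%:R * S) ^+ 3 + 24 * `|t| ^+ 2 * d%:R ^+ 2 * eta ^+ 2).
Proof.
move=> N0 cg g1 gS gosc veta.
have S0 : 0 <= S by exact: le_trans (gS 0).
pose psi := rearrange d N (t * N%:R) g.
have mpsi : measurable_fun setT psi by exact: measurable_rearrange.
have psiE A : measurable A -> lambda (psi @^-1` A) = lambda A by exact: rearrange_preserving.
pose tv : L2 lambda := L20_val (t *: v); pose tw : L2 nu := L20_val (t *: L v).
pose w : L2 nu := L20_val (L v).
pose G (x : circle R) := g (circle_repr x).
have mG : measurable_fun setT G.
  apply: (measurableT_comp (f := g)); first exact: continuous_measurable_fun.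
  exact: measurable_circle_repr.
pose q x := w x - transfer d 1 G x.
have mq : measurable_fun setT q.
  by apply: measurable_funB => //; exact: measurable_transfer.
pose p x := (v : L2 lambda) x - G x.
have mp : measurable_fun setT p by exact: measurable_funB.
have intq : (\int[lambda]_x ((q (psi x)) ^+ 2)%:E <= (d%:R ^+ 2 * eta ^+ 2)%:E)%E.
  rewrite (ge0_integral_preserving (f := fun x => ((q x) ^+ 2)%:E) mpsi psiE); last 2 first.
  - by apply/measurable_EFinP; exact: measurable_funX.
  - by move=> x; rewrite lee_fin sqr_ge0.
  (* Up to a null set [q] is the transfer of [p = v - g], so its norm is at most [d] times that of
     [p]. *)
  rewrite (ae_eq_sqr_integral (g := transfer d 1 p))//; last 2 first.
  - exact: measurable_transfer.
  - apply: filterS (ae_nu (LE v)) => x; rewrite /q /w => ->.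
    by rewrite /transfer /p -mulrBr -sumrB.
  apply: (le_trans (sqr_integral_transfer d_gt0 _ mp)).
  by rewrite mul1r [leRHS]EFinM lee_wpmul2l// lee_fin sqr_ge0.
pose E := [set x : circle R | near_end d N t S x].
have [mE lE] := near_end_measure t N0 S0; rewrite -/E in mE lE.
pose c := `|t|; have c0 : 0 <= c by exact: normr_ge0.
pose a1 : R := 3 * (4 * c * (d%:R * S)) ^+ 2; pose a2 := 6 * c ^+ 2 * d%:R ^+ 2.
pose a3 := 6 * c ^+ 2; pose a4 := 2 * a2 * eta ^+ 2.
have a10 : 0 <= a1 by rewrite mulr_ge0// sqr_ge0.
have a20 : 0 <= a2 by rewrite !mulr_ge0// sqr_ge0.
have a30 : 0 <= a3 by rewrite mulr_ge0// sqr_ge0.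
have a40 : 0 <= a4 by rewrite mulr_ge0 ?sqr_ge0// mulr_ge0.
pose h x : R := a1 * \1_E x + a2 * p x ^+ 2 + a3 * q (psi x) ^+ 2 + a4.
apply: (@wasserstein_le _ _ _ (fun x => expanding d (displace tv x)) (fun x => displace tw (psi x))).
- by apply: measurableT_comp; [exact: measurable_expanding|exact: measurable_displace].
- by apply: measurableT_comp => //; exact: measurable_displace.
- by [].
- move=> A mA; transitivity (nu (displace tw @^-1` A)); last by [].
  have mdA : measurable (displace tw @^-1` A).
    by rewrite -[X in measurable X]setTI; exact: measurable_displace.
  exact: (etrans (psiE _ mdA) (esym (nuE mdA))).
have ptw : {ae lambda, forall x, (mdist (expanding d (displace tv x)) (displace tw (psi x))) ^+ 2 <= h x}.
  have tvE : {ae lambda, forall x, tv x = t * v x} by exact: (L2_scaleE t (v : L2 lambda)).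
  have twE : {ae lambda, forall x, tw (psi x) = t * w (psi x)}.
    by apply: (ae_preserving (Q := fun z => tw z = t * w z) mpsi psiE); apply: ae_nu; exact: (L2_scaleE t w).
  move: tvE twE; apply: filterS2 => x tvx twx.
  have [Y [k [psiY est]]] := rearrange_estimate t d_gt0 N0 g1 gS gosc x (v x) (w (psi x)).
  rewrite -/psi in psiY est.
  have E1 : expanding d (displace tv x) = circle_proj (d%:R * (circle_repr x + t * v x) - k%:R).
    have -> : displace tv x = circle_proj (circle_repr x + t * v x) by rewrite -tvx.
    by rewrite expanding_proj -[RHS](circle_proj_addn _ k) subrK.
  have E2 : displace tw (psi x) = circle_proj (Y + t * w (psi x)).
    by rewrite -twx psiY displace_proj.
  have := circle_dist_proj (d%:R * (circle_repr x + t * v x) - k%:R) (Y + t * w (psi x)).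
  rewrite -E1 -E2 => /le_trans/(_ est).
  have sqn (r : R) : `|r| ^+ 2 = r ^+ 2 by rewrite real_normK ?num_real.
  set D := mdist _ _; have D0 : 0 <= D by exact: mdist_ge0.
  move=> H; apply: (le_trans (sqr_sum3_le D0 c0 H)).
  rewrite /h /a1 /a2 /a3 /a4 -/c indicE; apply: lerD => //; apply: lerD; last first.
    by rewrite -[X in _ <= _ * X]sqn /q /transfer mul1r.
  apply: lerD; last by rewrite -[X in _ <= _ * X]sqn.
  have [xE|xE] := boolP (near_end d N t S x); first by rewrite mem_set// mulr1.
  by rewrite memNset ?mulr0 ?expr0n ?mulr0//; apply/negP.
have mh1 : measurable_fun setT (fun x : circle R => (a1 * \1_E x)%:E).
  by apply/measurable_EFinP; apply: measurable_funM => //; exact: measurable_indic.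
have mh2 : measurable_fun setT (fun x => (p x ^+ 2)%:E).
  by apply/measurable_EFinP; exact: measurable_funX.
have mh3 : measurable_fun setT (fun x => (q (psi x) ^+ 2)%:E).
  by apply/measurable_EFinP; apply: measurable_funX; exact: measurableT_comp.
have pos2 x : (0 <= (p x ^+ 2)%:E)%E by rewrite lee_fin sqr_ge0.
have pos3 x : (0 <= (q (psi x) ^+ 2)%:E)%E by rewrite lee_fin sqr_ge0.
have hE x : ((h x)%:E = (a1%:E * (\1_E x)%:E + a2%:E * (p x ^+ 2)%:E) +
    a3%:E * (q (psi x) ^+ 2)%:E + a4%:E)%E by rewrite /h -!EFinM -!EFinD.
have mh : measurable_fun setT (fun x => (h x)%:E).
  under eq_fun do rewrite hE.
  apply: emeasurable_funD => //; apply: emeasurable_funD; last exact: emeasurable_funM.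
  by apply: emeasurable_funD => //; exact: emeasurable_funM.
apply: (@le_trans _ _ (\int[lambda]_x (h x)%:E)%E).
  apply: ae_ge0_le_integral => //.
  - by move=> x _; rewrite lee_fin sqr_ge0.
  - apply: (measurableT_comp (f := fun z : circle R * circle R => ((mdist z.1 z.2) ^+ 2)%:E)
      (g := fun x => (expanding d (displace tv x), displace tw (psi x)))).
      exact: measurable_circle_mdist.
    apply: measurable_fun_pair.
      by apply: measurableT_comp; [exact: measurable_expanding|exact: measurable_displace].
    by apply: measurableT_comp => //; exact: measurable_displace.
  - by move=> x _; rewrite lee_fin !addr_ge0// mulr_ge0// sqr_ge0.
  - by apply: filterS ptw => x H _; rewrite lee_fin.
under eq_integral do rewrite hE.
rewrite ge0_integralD//; last 2 first.
- by move=> x _; rewrite !adde_ge0// mule_ge0.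
- apply: emeasurable_funD; last exact: emeasurable_funM.
  by apply: emeasurable_funD => //; exact: emeasurable_funM.
rewrite ge0_integralD//; last 4 first.
- by move=> x _; rewrite !adde_ge0// mule_ge0.
- by apply: emeasurable_funD => //; exact: emeasurable_funM.
- by move=> x _; rewrite mule_ge0.
- exact: emeasurable_funM.
rewrite ge0_integralD//; last 3 first.
- by move=> x _; rewrite mule_ge0.
- by move=> x _; rewrite mule_ge0.
- exact: emeasurable_funM.
rewrite !ge0_integralZl//; last first.
  by apply/measurable_EFinP; exact: measurable_indic.
rewrite integral_indic// setIT integral_cst// [X in (_ + _ * X <= _)%E]probability_setT mule1.
apply: (@le_trans _ _ (a1%:E * (2 * margin d N t S)%:E + a2%:E * (eta ^+ 2)%:E +
  a3%:E * (d%:R ^+ 2 * eta ^+ 2)%:E + a4%:E)%E).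
  by rewrite !leeD// lee_wpmul2l.
rewrite -!EFinM -!EFinD lee_fin /a4 /a1 /a2 /a3 /margin normrM -/c.
rewrite (ger0_norm (ler0n R N)); rewrite le_eqVlt; apply/orP; left; apply/eqP; ring.
Qed.

End Gateaux.

Lemma transfer_gateaux {R : realType} (d : nat) (nu : probability (circle R) R)
    (L : {linear L20 (uniform_circle R) -> L20 nu}) (v : L20 (uniform_circle R)) (e : R) :
  (0 < d)%N -> (forall A, measurable A -> nu A = uniform_circle R A) ->
  (forall v, {ae nu, forall x, L v x = transfer d 1 v x}) -> 0 < e ->
  \forall t \near (0 : R), wasserstein
    (distribution (displacement (t *: v : L20 (uniform_circle R))) (expanding d))
    (displacement (t *: L v : L20 nu)) <= e * `|t|.
Proof.
move=> d_gt0 nuE LE e0; have d0 : 0 < d%:R :> R by rewrite ltr0n.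
(* This makes [24 d^2 eta^2] equal to [3/8 e^2]; the radius chosen for [t] below bounds the other
   term by [1/2 e^2 t^2], and [3/8 + 1/2 < 1]. *)
pose eta : R := e / (8 * d%:R).
have eta0 : 0 < eta by rewrite divr_gt0// mulr_gt0.
have := L20_valP v; rewrite inE => /closure_normP/(_ eta eta0)[s [phi [sphi sE]] vs].
pose g := derive1 (circle_lift phi).
have sg : smooth g by move=> n x; have := sphi n.+1 x; rewrite derive1Sn.
have g1 : forall x, g (x + 1) = g x.
  exact: derive1_periodic sphi (circle_lift_periodic phi).
have cg : continuous g by exact: circle_deriv_continuous.
have [S S0 gS] := periodic_bounded cg g1.
have [M M0 gM] := smooth_periodic_lipschitz sg g1.
(* Cells so short that a function with Lipschitz constant [M] oscillates by at most [eta] on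
   each. *)
pose N := (Num.trunc (M / eta)).+1.
have NM : M / N%:R <= eta.
  by rewrite ler_pdivrMr// mulrC -ler_pdivrMr// ltW// truncnS_gt.
have gosc x y : `|x - y| <= N%:R^-1 -> `|g x - g y| <= eta.
  by move=> xy; apply: (le_trans (gM x y)); apply: le_trans NM; rewrite ler_wpM2l.
have veta : (\int[uniform_circle R]_x (((v : L2 _) x - g (circle_repr x)) ^+ 2)%:E <= (eta ^+ 2)%:E)%E.
  have mf : measurable_fun setT (fun x : circle R => (v : L2 _) x - circle_deriv phi x).
    by apply: measurable_funB; [exact: L2_measurable|exact: measurable_circle_deriv].
  have E : {ae uniform_circle R, forall x, (L20_val v - s : L2 _) x = (v : L2 _) x - circle_deriv phi x}.
    by move: (L2_subE (L20_val v) s) sE; apply: filterS2 => x -> ->.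
  by rewrite -(L2_norm_ae mf E) lee_fin ler_pXn2r ?nnegrE ?(ltW eta0)// ltW.
pose K : R := 192 * N%:R * (d%:R * S) ^+ 3.
have K0 : 0 <= K by rewrite mulr_ge0// exprn_ge0// mulr_ge0// ltW.
have h0 : 0 < e ^+ 2 / 2 / (K + 1) by rewrite !divr_gt0// ?exprn_gt0// ltr_wpDl.
apply/nbhs_ballP; exists (e ^+ 2 / 2 / (K + 1)) => // t.
rewrite -ball_normE/= sub0r normrN ltr_pdivlMr ?ltr_wpDl// => tK.
apply: (le_trans (wasserstein_transfer_le d_gt0 nuE LE t (ltn0Sn _) cg g1 gS gosc veta)).
have -> : e * `|t| = Num.sqrt ((e * `|t|) ^+ 2).
  by rewrite sqrtr_sqr [RHS]ger0_norm// mulr_ge0// ltW.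
rewrite -/N ler_wsqrtr//.
have -> : 24 * `|t| ^+ 2 * d%:R ^+ 2 * eta ^+ 2 = 3 / 8 * e ^+ 2 * `|t| ^+ 2.
  by rewrite /eta; move: `|t| => a; field; rewrite gt_eqF.
have -> : 192 * `|t| ^+ 3 * N%:R * (d%:R * S) ^+ 3 = (`|t| * K) * `|t| ^+ 2.
  by rewrite /K; ring.
rewrite -mulrDl exprMn ler_wpM2r ?sqr_ge0//.
have := normr_ge0 t; have : 0 <= e ^+ 2 by exact: sqr_ge0.
by move: tK; rewrite mulrDr mulr1; move: `|t| (e ^+ 2) => a b; lra.
Qed.

Theorem theorem1p2 (R : realType) (d : nat) (hd : (2 <= d)%N) :
  exists (L : {linear L20 (uniform_circle R) ->
                      L20 (push_expanding d (uniform_circle R))})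
         (P : {linear L20 (uniform_circle R) -> L20 (uniform_circle R)}),
    [/\ gateaux_derivative (push_expanding d) (uniform_circle R) L,
        perron_frobenius d P,
        forall v, {ae uniform_circle R, forall x, L v x = d%:R * P v x},
        complex_spectrum (d%:R \*: P) = [set z : R[i] | `|z| <= d%:R] &
        forall z : R[i], `|z| < d%:R ->
          infinite_dimensional (complex_eigenspace (d%:R \*: P) z)].
Proof.
have d_gt0 : (0 < d)%N by exact: ltnW.
have dR0 : d%:R != 0 :> R by rewrite pnatr_eq0 -lt0n.
have nuE A : measurable A -> push_expanding d (uniform_circle R) A = uniform_circle R A.
  exact: uniform_circle_expanding.
have [K [KE Kle]] := koopman_exists (R := R) d_gt0.
have [P [PE Ple]] := @transfer_exists R d d_gt0 (uniform_circle R) d%:R^-1 (fun _ _ => erefl).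
(* [L] is built separately from [P]: its values lie over the push-forward measure, which is known to
   agree with lambda on measurable sets. *)
have [L [LE Lle]] := @transfer_exists R d d_gt0 _ 1 nuE.
have P_contract u : `|P u| <= `|u|.
  by rewrite -(@ler_pXn2r _ 2)// ?nnegrE//; apply: le_trans (Ple u) _; rewrite mulVf// expr1n mul1r.
have K_contract u : `|K u| <= `|u|.
  by rewrite -(@ler_pXn2r _ 2)// ?nnegrE//; apply: le_trans (Kle u) _; rewrite mul1r.
have PK := transfer_koopman d_gt0 KE PE.
have [v [Pv vfree]] := transfer_kernel_family hd PE.
have complete := @L20_abs_summable_cvg R (uniform_circle R).
have eigen (z : R[i]) : cmod z < d%:R ->
    infinite_dimensional (complex_eigenspace (d%:R \*: P) z).
  by move=> zd; apply: (eigenspace_infinite_dimensional complete d_gt0 PK K_contract zd Pv vfree).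
have natC : d%:R = ((d%:R : R)%:C)%C :> R[i] by rewrite rmorph_nat.
exists L, P; split.
- split.
  + exact: uniform_circle_atomless.
  + move=> x; rewrite nuE; first exact: uniform_circle_atomless.
    rewrite (_ : [set x] = @circle_repr R @^-1` [set circle_repr x]).
      by rewrite -[X in measurable X]setTI; exact: measurable_circle_repr.
    by apply/seteqP; split => y /= [] => [->//|/val_inj].
  + apply: (@bounded_continuous _ _ _ L d%:R) => u.
    rewrite -(@ler_pXn2r _ 2)// ?nnegrE ?mulr_ge0//; apply: le_trans (Lle u) _.
    by rewrite mul1r exprMn.
  + move=> u; apply/eqoP => e e0.
    apply: filterS (transfer_gateaux u d_gt0 nuE LE e0) => t.
    by move=> Wt; rewrite /= ger0_norm ?sqrtr_ge0.
- by exists K => // u w; exact: (transfer_adjoint d_gt0 KE PE).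
- move=> u; move: (ae_nu nuE (LE u)) (PE u); apply: filterS2 => x -> ->.
  by rewrite /transfer mul1r mulVKf.
- apply/seteqP; split => z /=; rewrite normr_cmod natC lecR.
    by apply: contraPP => /negP; rewrite -ltNge; exact: (resolvent complete d_gt0 P_contract).
  apply: (complex_spectrum_disc d_gt0) => // z' z'd.
  (* A free family of one element is a nonzero eigenvector. *)
  have [w wE wfree] := eigen z' z'd 1%N.
  exists (w ord0); last exact: wE.
  apply/eqP => w0; have := wfree (fun=> 1).
  rewrite big_ord1 w0 scaler0 => /(_ erefl ord0)/eqP; by rewrite oner_eq0.
- by move=> z; rewrite normr_cmod natC ltcR; exact: eigen.
Qed.
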